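(* In the Bayesian $k$-armed bandit problem described in the context, suppose every $P_\mu\in\mathcal{F}$ is $1$-subgaussian (i.e. for $Z\sim P_\mu$ and all real $s$, $\mathbb{E}[\exp(s(Z-\mu))]\le\exp(s^2/2)$), and that there is $D_0$ with $g(x)\le D_0$ for all $x\in[0,1]$. Then the Bayesian regret of the UCB algorithm satisfies $$BR_{T,k}(\mathrm{UCB})\le k\bigl[1+D_0+D_0(10+18\log f(T))(2+2\log k+\log T)\bigr],$$ where $f(t)=1+t\log^2 t$.
   Context: Bayesian $k$-armed bandit: horizon $T$, arms $[k]$. $\mathcal{F}=\{P_\mu:\mu\in[0,1]\}$ reward distributions, $P_\mu$ with mean $\mu$; prior $\Gamma$ on $[0,1]$ with density $g$; means $\mu_1,\dots,\mu_k$ i.i.d. $\sim\Gamma$; pulling arm $i$ at time $t$ gives $Y_{it}\sim P_{\mu_i}$ independently, only the pulled arm's reward observed. For a policy $\pi$, $R_T(\pi\mid\bm\mu)=T\max_i\mu_i-\sum_{t=1}^T\mathbb{E}[\mu_{a_t}\mid\pi]$ and $BR_{T,k}(\pi)=\mathbb{E}[R_T(\pi\mid\bm\mu)]$ (expectation also over the prior). $N_i(t)=\sum_{s\le t}\mathbf 1(a_s=i)$, $\hat\mu_i(t)=\sum_{s\le t}Y_{is}\mathbf 1(a_s=i)/N_i(t)$ (set to $1$ if $N_i(t)=0$), $f(t)=1+t\log^2(t)$, $\log$ natural. UCB algorithm: for $t\le k$ pull arm $t$; for $t\ge k+1$ pull $\arg\max_i\bigl[\hat\mu_i(t-1)+\sqrt{2\log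 f(t)/N_i(t-1)}\bigr]$. *)

(* Defs.v *)
From mathcomp Require Import all_boot all_order all_algebra.
From mathcomp Require Import all_classical all_reals all_analysis measurable_realfun.
Set Implicit Arguments. Unset Strict Implicit. Unset Printing Implicit Defensive.
Import Order.TTheory GRing.Theory Num.Theory.
Import numFieldNormedType.Exports.
Local Open Scope classical_set_scope.
Local Open Scope ring_scope.

Section Bandit.
Variable R : realType.

Definition flog (t : nat) : R := 1 + t%:R * (ln (t%:R : R)) ^+ 2.

Definition argmax_first (k : nat) (F : nat -> R) : nat :=
  foldl (fun b i => if F b < F i then i else b) 0%N (iota 1 k.-1).

(* number of pulls of arm i in history h (h = actions at times 1..size h) *)
Definition pulls (h : seq nat) (i : nat) : nat := count (pred1 i) h.

(* empirical mean of arm i; Y i t = reward of arm i at time t (t >= 1);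
   set to 1 if the arm was never pulled *)
Definition mean_hat (Y : nat -> nat -> R) (h : seq nat) (i : nat) : R :=
  if pulls h i == 0%N then 1 else
  (\sum_(s < size h) (if nth 0%N h s == i then Y i s.+1 else 0))
    / (pulls h i)%:R.

Definition ucb_index (Y : nat -> nat -> R) (h : seq nat) (t i : nat) : R :=
  mean_hat Y h i + Num.sqrt (2 * ln (flog t) / (pulls h i)%:R).

(* action at time t (>= 1) given history h of actions at times 1..t-1;
   arms are numbered 0..k-1 (arm "t" of the paper is arm t-1 here) *)
Definition ucb_choose (k : nat) (Y : nat -> nat -> R) (t : nat) (h : seq nat)
  : nat :=
  if (t <= k)%N then t.-1 else argmax_first k (ucb_index Y h t).

Fixpoint ucb_hist (k : nat) (Y : nat -> nat -> R) (t : nat) : seq nat :=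
  match t with
  | 0 => [::]
  | t'.+1 => rcons (ucb_hist k Y t') (ucb_choose k Y t'.+1 (ucb_hist k Y t'))
  end.

Definition ucb_action (k : nat) (Y : nat -> nat -> R) (t : nat) : nat :=
  ucb_choose k Y t (ucb_hist k Y t.-1).

(* Iterated integral = expectation of h(X_1,...,X_n) with X_j independent,
   X_j ~ mus_j. *)
Fixpoint iint (mus : seq (probability R R)) (h : seq R -> \bar R) : \bar R :=
  match mus with
  | [::] => h [::]
  | mu :: mus' => (\int[mu]_x iint mus' (fun xs => h (x :: xs)))%E
  end.

(* the reward table Y_{it}, i < k, 1 <= t <= T, read from a list of length k*T *)
Definition table (T : nat) (ys : seq R) : nat -> nat -> R :=
  fun i t => nth 0 ys (i * T + t.-1).

Definition reward_laws (P : R -> probability R R) (k T : nat) (m : seq R)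
  : seq (probability R R) :=
  [seq P (nth 0 m (j %/ T)) | j <- iota 0 (k * T)].

Definition ucb_regret (P : R -> probability R R) (k T : nat) (m : seq R)
  : \bar R :=
  ((T%:R * \big[Num.max/nth 0 m 0]_(i < k) nth 0 m i)%:E -
   \sum_(1 <= t < T.+1)
     iint (reward_laws P k T m)
          (fun ys => (nth 0 m (ucb_action k (table T ys) t))%:E))%E.

Definition ucb_bayes_regret (P : R -> probability R R) (Gam : probability R R)
  (k T : nat) : \bar R :=
  iint (nseq k Gam) (ucb_regret P k T).

End Bandit.

(* Main.v *)
From HB Require Import structures.
Require Import Defs.
From mathcomp Require Import all_boot all_order all_algebra.
From mathcomp Require Import all_classical all_reals all_analysis measurable_realfun.
From mathcomp Require Import ring lra zify.
Import Order.TTheory GRing.Theory Num.Theory.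
Import numFieldNormedType.Exports.
Local Open Scope classical_set_scope.
Local Open Scope ring_scope.

(** For fixed means, an arm [i] of gap [d = 2 h] is pulled after the initial
    round only if the index of the best arm is off by [h] or the empirical mean
    of [i] is too high although it already has [8 ln f(T) / h^2] pulls.  Since
    pulls are adaptive, both events are bounded through the supermartingale
    [prod_t exp (lam (Y_t - mu) - lam^2 / 2)], the product being over the times
    at which a predictable 0-1 weight is on; integrating out one coordinate of
    the reward table at a time, in reverse order of time, shows that its mean is
    at most 1.  This gives [E N_i <= 1 + (56 + 32 ln f(T)) / d^2], so arm [i]
    costs at most [T c] when [d <= c] and [1 + (56 + 32 ln f(T)) / d] otherwise.
    Under the prior, given the other arms, the gap of [i] has density at most
    [D0], and with [c = 1 / sqrt T] the cost integrates to at most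
    [D0 (2 + (28 + 16 ln f(T)) ln T)]. *)

(** * Iterated integrals *)

HB.instance Definition _ (R : realType) := isPointed.Build (seq R) [::].

(* Lists carry the product sigma-algebra of the coordinates [nth 0 _ j], which
   makes lists of all lengths points of one measurable space. *)
Definition cylinders (R : realType) : set (set (seq R)) :=
  [set A | exists j (B : set R), measurable B /\ A = (fun ys => nth 0 ys j) @^-1` B].

Notation seqM R := (g_sigma_algebraType (cylinders R)).

Lemma measurable_nth (R : realType) j :
  measurable_fun setT (fun ys : seqM R => nth 0 (ys : seq R) j : R).
Proof.
move=> _ B mB; rewrite setTI; apply: sub_sigma_algebra.
by exists j, B.
Qed.

Lemma measurable_seq (R : realType) d (S : measurableType d) (f : S -> seqM R) :
  (forall j, measurable_fun setT (fun s => nth 0 (f s : seq R) j : R)) ->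
  measurable_fun setT f.
Proof.
move=> mf; apply: (@measurability _ _ _ _ setT f (cylinders R : set (set (seqM R)))).
  by [].
move=> _ [_ [j [B [mB ->]]] <-].
exact: mf.
Qed.

(** The integral of a nonnegative function is a supremum over the simple functions below it, hence
    monotone for arbitrary functions. The regret, as a function of the means, is compared with a
    measurable bound in this way. *)
Lemma le_integral_pointwise d (S : measurableType d) (R : realType)
    (mu : {measure set S -> \bar R}) (f g : S -> \bar R) :
  (forall x, f x <= g x)%E -> (\int[mu]_x f x <= \int[mu]_x g x)%E.
Proof.
move=> fg; rewrite integralE [leRHS]integralE.
have nn (f1 g1 : S -> \bar R) : (forall x, 0 <= f1 x)%E -> (forall x, f1 x <= g1 x)%E ->
    (\int[mu]_x f1 x <= \int[mu]_x g1 x)%E.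
  move=> f0 fg1.
  rewrite !ge0_integralTE//; last by move=> x; exact: le_trans (f0 x) (fg1 x).
  apply: ereal_sup_le => _ [h /= hf <-]; exists h => //= x.
  exact: le_trans (hf x) (fg1 x).
apply: leeB; apply: nn => // x.
- by rewrite !funeposE ge_max !le_max lexx orbT andbT fg.
- by rewrite !funenegE ge_max !le_max lexx orbT andbT leeN2 fg.
Qed.

Lemma measurable_cons (R : realType) d (S : measurableType d)
    (f : S -> R) (g : S -> seqM R) :
  measurable_fun setT f -> measurable_fun setT g ->
  measurable_fun setT (fun s => f s :: (g s : seq R) : seqM R).
Proof.
move=> mf mg; apply: measurable_seq => -[//|j] /=.
exact: (measurableT_comp (measurable_nth _ j) mg).
Qed.

Lemma integral_cst_probability d (S : measurableType d) (R : realType)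
    (mu : probability S R) (c : \bar R) : (\int[mu]_x c = c)%E.
Proof.
rewrite integral_cst// -[RHS]mule1; congr (_ * _)%E.
exact: probability_setT.
Qed.

Section IteratedIntegral.
Context {R : realType}.
Local Open Scope ereal_scope.
Implicit Types (mus : seq (probability R R)).

Lemma eq_iint mus (f g : seq R -> \bar R) :
  f =1 g -> iint mus f = iint mus g.
Proof. by move=> /funext ->. Qed.

Lemma le_iint mus (f g : seq R -> \bar R) :
  (forall ys, f ys <= g ys) -> iint mus f <= iint mus g.
Proof.
elim: mus f g => [|mu mus ih] f g fg /=; first exact: fg.
by apply: le_integral_pointwise => x; apply: ih => ys; exact: fg.
Qed.

Lemma iint_ge0 mus (f : seq R -> \bar R) :
  (forall ys, 0 <= f ys) -> 0 <= iint mus f.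
Proof.
elim: mus f => [|mu mus ih] f f0 /=; first exact: f0.
by apply: integral_ge0 => x _; apply: ih.
Qed.

Lemma iint_cst mus (c : \bar R) : iint mus (fun=> c) = c.
Proof.
elim: mus => //= mu mus ->.
exact: integral_cst_probability.
Qed.

(** The head of the list is moved into the parameter, from [S] to [S * R], so the induction ranges
    over all parameter spaces; each step is the measurability half of Tonelli's theorem. *)
Lemma measurable_iint mus d (S : measurableType d) (h : S -> seq R -> \bar R) :
  (forall s ys, 0 <= h s ys) ->
  measurable_fun setT (fun p : S * seqM R => h p.1 p.2) ->
  measurable_fun setT (fun s => iint mus (h s)).
Proof.
elim: mus d S h => [|mu mus ih] d S h h0 mh /=.
  apply: (measurableT_comp mh (g := fun s => (s, [::] : seqM R))).
  by apply: measurable_fun_pair => //; exact: measurable_cst.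
pose f (p : S * R) := iint mus (fun xs => h p.1 (p.2 :: xs)).
have mf : measurable_fun setT f.
  apply: (ih _ _ (fun p xs => h p.1 (p.2 :: xs))) => [s ys|]; first exact: h0.
  apply: (measurableT_comp mh
    (g := fun q : (S * R) * seqM R => (q.1.1, q.1.2 :: (q.2 : seq R) : seqM R))).
  apply: measurable_fun_pair; first exact: measurableT_comp.
  by apply: measurable_cons => //; exact: measurableT_comp.
apply: (measurable_fun_fubini_tonelli_F f) => // p.
by apply: iint_ge0 => ys; exact: h0.
Qed.

Lemma measurable_fun_cons (h : seq R -> \bar R) :
  measurable_fun setT (h : seqM R -> \bar R) ->
  measurable_fun setT (fun p : R * seqM R => h (p.1 :: (p.2 : seq R))).
Proof.
move=> mh.
apply: (measurableT_comp mh (g := fun p : R * seqM R => p.1 :: (p.2 : seq R) : seqM R)).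
exact: measurable_cons.
Qed.

Lemma measurable_fun_cons1 (h : seq R -> \bar R) x :
  measurable_fun setT (h : seqM R -> \bar R) ->
  measurable_fun setT ((fun ys => h (x :: ys)) : seqM R -> \bar R).
Proof.
move=> mh.
apply: (measurableT_comp mh (g := fun ys : seqM R => x :: (ys : seq R) : seqM R)).
by apply: measurable_cons => //; exact: measurable_cst.
Qed.

Lemma iintD mus (f g : seq R -> \bar R) :
  (forall ys, 0 <= f ys) -> (forall ys, 0 <= g ys) ->
  measurable_fun setT (f : seqM R -> \bar R) ->
  measurable_fun setT (g : seqM R -> \bar R) ->
  iint mus (fun ys => f ys + g ys) = iint mus f + iint mus g.
Proof.
elim: mus f g => //= mu mus ih f g f0 g0 mf mg.
rewrite -ge0_integralD//; first last.
- apply: (measurable_iint _ _ _ (fun x ys => g (x :: ys))) => //.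
  exact: measurable_fun_cons.
- by move=> x _; exact: iint_ge0.
- apply: (measurable_iint _ _ _ (fun x ys => f (x :: ys))) => //.
  exact: measurable_fun_cons.
- by move=> x _; exact: iint_ge0.
by apply: eq_integral => x _; rewrite ih//; exact: measurable_fun_cons1.
Qed.

Lemma iintZl mus (c : R) (f : seq R -> \bar R) :
  (0 <= c)%R -> (forall ys, 0 <= f ys) ->
  measurable_fun setT (f : seqM R -> \bar R) ->
  iint mus (fun ys => c%:E * f ys) = c%:E * iint mus f.
Proof.
move=> c0; elim: mus f => //= mu mus ih f f0 mf.
rewrite -ge0_integralZl//; first last.
- by move=> x _; exact: iint_ge0.
- apply: (measurable_iint _ _ _ (fun x ys => f (x :: ys))) => //.
  exact: measurable_fun_cons.
by apply: eq_integral => x _; rewrite ih//; exact: measurable_fun_cons1.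
Qed.

Lemma iint_sum mus I (s : seq I) (p : pred I) (f : I -> seq R -> \bar R) :
  (forall i ys, 0 <= f i ys) ->
  (forall i, measurable_fun setT (f i : seqM R -> \bar R)) ->
  iint mus (fun ys => \sum_(i <- s | p i) f i ys) = \sum_(i <- s | p i) iint mus (f i).
Proof.
move=> f0 mf; elim: s => [|i s ih].
  by rewrite big_nil; under eq_iint do rewrite big_nil; exact: iint_cst.
rewrite big_cons -ih; case: ifPn => pi; last first.
  by apply: eq_iint => ys; rewrite big_cons (negbTE pi).
rewrite -iintD//.
- by apply: eq_iint => ys; rewrite big_cons pi.
- by move=> ys; exact: sume_ge0.
- under eq_fun do rewrite -big_filter.
  exact: emeasurable_sum.
Qed.

Lemma integral_iint mus d (S : measurableType d)
    (mu : {sigma_finite_measure set S -> \bar R}) (h : S -> seq R -> \bar R) :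
  (forall s ys, 0 <= h s ys) ->
  measurable_fun setT (fun p : S * seqM R => h p.1 p.2) ->
  \int[mu]_s iint mus (h s) = iint mus (fun ys => \int[mu]_s h s ys).
Proof.
elim: mus h => //= nu mus ih h h0 mh.
rewrite (fubini_tonelli (fun p : S * R => iint mus (fun xs => h p.1 (p.2 :: xs)))) /=.
- apply: eq_integral => x _.
  rewrite (ih (fun s xs => h s (x :: xs)))//.
  apply: (measurableT_comp mh
    (g := fun q : S * seqM R => (q.1, x :: (q.2 : seq R) : seqM R))).
  apply: measurable_fun_pair => //.
  by apply: measurable_cons => //; exact: measurable_cst.
- apply: (measurable_iint _ _ _ (fun p xs => h p.1 (p.2 :: xs))) => [s ys|]; first exact: h0.
  apply: (measurableT_comp mh
    (g := fun q : (S * R) * seqM R => (q.1.1, q.1.2 :: (q.2 : seq R) : seqM R))).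
  apply: measurable_fun_pair; first exact: measurableT_comp.
  by apply: measurable_cons => //; exact: measurableT_comp.
- by move=> p; exact: iint_ge0.
Qed.

(* Fubini: coordinate [j] may be integrated out first, whatever its position. *)
Lemma iint_set_nth mu0 mus j (h : seq R -> \bar R) :
  (j < size mus)%N -> (forall ys, 0 <= h ys) ->
  measurable_fun setT (h : seqM R -> \bar R) ->
  iint mus h = iint mus (fun ys => \int[nth mu0 mus j]_x h (set_nth 0%R ys j x)).
Proof.
elim: mus j h => [//|mu mus ih] [|j] h /= jn h0 mh.
  rewrite integral_iint//; last exact: measurable_fun_cons.
  (* [set_nth] overwrites the head, so the remaining outer integral is that of a constant. *)
  by rewrite integral_cst_probability.
apply: eq_integral => z _; rewrite (ih j)//; exact: measurable_fun_cons1.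
Qed.

(* No measurability of [f] is needed: off [D] the bound may be replaced by [+oo]. *)
Lemma le_iint_in mus (D : set R) (f g : seq R -> \bar R) :
  measurable D -> (forall mu, mu \in mus -> mu (~` D) = 0) ->
  (forall ys, 0 <= g ys) -> measurable_fun setT (g : seqM R -> \bar R) ->
  (forall ys, size ys = size mus -> (forall y, y \in ys -> D y) -> f ys <= g ys) ->
  iint mus f <= iint mus g.
Proof.
move=> mD; elim: mus f g => [|mu mus ih] f g muD g0 mg fg /=; first exact: fg.
have mG : measurable_fun setT (fun x => iint mus (fun xs => g (x :: xs))).
  apply: (measurable_iint _ _ _ (fun x ys => g (x :: ys))) => //.
  exact: measurable_fun_cons.
pose G x := if x \in D then iint mus (fun xs => g (x :: xs)) else +oo.
rewrite (_ : \int[mu]_x iint mus (fun xs => g (x :: xs)) = \int[mu]_x G x).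
  apply: le_integral_pointwise => x; rewrite /G; case: ifPn => xD; last exact: leey.
  apply: ih => //; [|exact: measurable_fun_cons1|].
    by move=> nu numus; apply: muD; rewrite inE numus orbT.
  move=> ys sys ysD; apply: fg => /=; first by rewrite sys.
  by move=> y; rewrite inE => /predU1P[->|/ysD//]; move: xD; rewrite inE.
apply: ge0_ae_eq_integral => //.
- apply: measurable_fun_ifT => //.
  apply: (measurable_fun_bool true) => //.
  rewrite setTI (_ : _ @^-1` _ = D)//.
  by apply/seteqP; split=> x; [exact: set_mem|exact: mem_set].
- by move=> x _; exact: iint_ge0.
- by move=> x _; rewrite /G; case: ifPn => // _; exact: iint_ge0.
exists (~` D); split; [exact: measurableC|by apply: muD; rewrite inE eqxx|].
by move=> x; apply: contra_not => Dx _; rewrite /G mem_set.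
Qed.

End IteratedIntegral.

(** * Concentration under adaptive sampling *)

Lemma measurable_fun_EFin d (S : measurableType d) (R : realType) (f : S -> R) :
  measurable_fun setT f -> measurable_fun setT (fun x => (f x)%:E).
Proof. by move=> mf; exact/measurable_EFinP. Qed.

Lemma gee_pMr_fin (R : realType) (c : R) (x : \bar R) :
  0 <= c -> (x <= 1)%E -> (c%:E * x <= c%:E)%E.
Proof.
by move=> c0 x1; rewrite -[leRHS]mule1; apply: lee_wpmul2l; rewrite ?lee_fin.
Qed.

Section Concentration.
Context {R : realType}.
Variables (mus : seq (probability R R)) (mu0 : probability R R).
Variables (p : nat -> nat) (w : nat -> seq R -> bool) (T : nat).
Hypothesis p_size : forall t, (t < T)%N -> (p t < size mus)%N.
Hypothesis p_inj : injective p.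
Hypothesis mw : forall t, measurable_fun setT (w t : seqM R -> bool).
Hypothesis w_predictable : forall s t ys x, (s <= t)%N -> (t < T)%N ->
  w s (set_nth 0 ys (p t) x) = w s ys.

Lemma measurable_fun_natb d (S : measurableType d) (b : S -> bool) :
  measurable_fun setT b -> measurable_fun setT (fun s => (b s)%:R : R).
Proof.
move=> mb; rewrite (_ : (fun _ => _) = (fun s => if b s then 1 else 0)); last first.
  by apply/funext => s; case: (b s).
exact: measurable_fun_ifT.
Qed.

(** The exponential supermartingale, once [xi] is normalised to have mean at most 1: only the times
    at which [w] is on contribute a factor. *)
Let M (xi : R -> R) n ys := \prod_(0 <= t < n) (if w t ys then xi (nth 0 ys (p t)) else 1).

Let measurable_M xi n : measurable_fun setT xi ->
  measurable_fun setT (M xi n : seqM R -> R).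
Proof.
move=> mxi; apply: measurable_prod => t _.
apply: measurable_fun_ifT => //.
exact: (measurableT_comp mxi (measurable_nth _ (p t))).
Qed.

Lemma iint_supermartingale (xi : R -> R) n :
  measurable_fun setT xi -> (forall x, 0 <= xi x) ->
  (n <= T)%N -> (forall t, (t < n)%N -> (\int[nth mu0 mus (p t)]_x (xi x)%:E <= 1)%E) ->
  (iint mus (fun ys => (M xi n ys)%:E) <= 1)%E.
Proof.
move=> mxi xi0.
have M0 k ys : 0 <= M xi k ys by apply: prodr_ge0 => t _; case: ifP.
elim: n => [|n ih] nT xi1.
  by rewrite (eq_iint _ _ (fun=> 1%E)) ?iint_cst// => ys; rewrite /M big_geq.
apply: (@le_trans _ _ (iint mus (fun ys => (M xi n ys)%:E))); last first.
  by apply: ih => [|t tn]; [exact: ltnW|apply: xi1; exact: leqW].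
rewrite (iint_set_nth mu0 _ (p n))//; first last.
- by apply: measurable_fun_EFin; exact: measurable_M.
- by move=> ys; rewrite lee_fin.
- exact: p_size.
apply: le_iint => ys.
under eq_integral => x _.
  (* Coordinate [p n] enters only the last factor: the weights up to [n] are predictable, and the
     earlier factors read other coordinates because [p] is injective. *)
  rewrite /M big_nat_recr//= nth_set_nth /= eqxx w_predictable//.
  rewrite (eq_big_nat _ _ (F2 := fun t => if w t ys then xi (nth 0 ys (p t)) else 1)); last first.
    move=> t /andP[_ tn]; rewrite w_predictable// 1?ltnW//.
    by rewrite nth_set_nth /= (inj_eq p_inj) ltn_eqF.
  rewrite EFinM.
  over.
rewrite -/(M xi n ys) /=; case: (w n ys).
  rewrite ge0_integralZl_EFin//; first last.
  - exact: measurable_fun_EFin.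
  - by move=> x _; rewrite lee_fin.
  by apply: gee_pMr_fin; [exact: M0|exact: xi1].
by rewrite mule1 integral_cst_probability.
Qed.

(** Multiplying by [lam] lets one inequality serve both tails: the centred sum is at least [lam * s]
    when [lam] is positive and at most [lam * s] when it is negative. *)
Definition deviates (m lam : R) (n s : nat) (ys : seq R) : bool :=
  (\sum_(0 <= t < n) w t ys == s)%N &&
  (lam ^+ 2 * s%:R <= lam * \sum_(0 <= t < n) (if w t ys then nth 0 ys (p t) - m else 0)).

Lemma measurable_deviates m lam n s :
  measurable_fun setT (deviates m lam n s : seqM R -> bool).
Proof.
apply: measurable_and.
  rewrite (_ : (fun _ => _) =
      (fun ys : seqM R => \sum_(0 <= t < n) ((w t ys)%:R : R) == s%:R)); last first.
    by apply/funext => ys; rewrite -natr_sum eqr_nat.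
  apply: measurable_fun_eqr => //; apply: measurable_sum => t.
  exact: measurable_fun_natb.
apply: measurable_fun_ler => //; apply: measurable_funM => //.
apply: measurable_sum => t; apply: measurable_fun_ifT => //.
by apply: measurable_funB => //; exact: measurable_nth.
Qed.

(** Chernoff's argument: with exactly [s] active times, the event forces the supermartingale to be
    at least [expR (s * lam ^+ 2 / 2)], while its mean is at most 1. *)
Lemma iint_deviates (m lam : R) n s :
  (n <= T)%N -> (forall t, (t < n)%N ->
    (\int[nth mu0 mus (p t)]_x (expR (lam * (x - m)))%:E <= (expR (lam ^+ 2 / 2))%:E)%E) ->
  (iint mus (fun ys => (deviates m lam n s ys)%:R%:E) <=
   (expR (- (s%:R * lam ^+ 2 / 2)))%:E)%E.
Proof.
move=> nT subg; pose xi x := expR (- (lam ^+ 2 / 2)) * expR (lam * (x - m)).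
have mxi0 : measurable_fun setT (fun x : R => expR (lam * (x - m))).
  apply: measurableT_comp => //; apply: measurable_funM => //.
  exact: measurable_funB.
have mxi : measurable_fun setT xi by exact: measurable_funM.
have xi0 x : 0 <= xi x by rewrite mulr_ge0 ?expR_ge0.
set c := expR _.
have c0 : 0 <= c by exact: expR_ge0.
apply: (@le_trans _ _ (iint mus (fun ys => c%:E * (M xi n ys)%:E)%E)).
  apply: le_iint => ys; rewrite -EFinM lee_fin /deviates.
  have M0 : 0 <= M xi n ys by apply: prodr_ge0 => t _; case: ifP.
  case: andP => [[/eqP Ns dev]|_]; last by rewrite mulr_ge0.
  rewrite (_ : M xi n ys = expR (lam * (\sum_(0 <= t < n) (if w t ys then nth 0 ys (p t) - m else 0))
     - s%:R * (lam ^+ 2 / 2))).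
    rewrite /c -expRD /= -[leLHS]expR0 ler_expR.
    by move: dev; set S := \sum_(0 <= t < n) _; set q := s%:R => dev; nra.
  rewrite -Ns natr_sum mulr_suml mulr_sumr -sumrB.
  rewrite (big_morph expR (@expRD R) (expR0 R)); apply: eq_bigr => t _.
  case: (w t ys); last by rewrite mulr0 mul0r subr0 expR0.
  by rewrite /xi -expRD mul1r addrC.
rewrite iintZl//; first last.
- by apply: measurable_fun_EFin; exact: measurable_M.
- by move=> ys; rewrite lee_fin; apply: prodr_ge0 => t _; case: ifP.
apply: gee_pMr_fin => //; apply: iint_supermartingale => // t tn.
under eq_integral do rewrite EFinM.
rewrite ge0_integralZl_EFin ?expR_ge0//; last exact: measurable_fun_EFin.
apply: le_trans (lee_wpmul2l _ (subg _ tn)) _; first by rewrite lee_fin expR_ge0.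
by rewrite -EFinM lee_fin -expRD addNr expR0.
Qed.

End Concentration.

(** * Measurability and elementary properties of UCB *)

Section DiscreteMeasurability.
Context {d} {S : measurableType d}.

(** Discrete measurability, for maps such as actions and histories whose values range over a
    countable type. *)
Definition measurable_fibers {I : Type} (X : S -> I) :=
  forall v, measurable (X @^-1` [set v]).

Lemma measurable_fibers_case (I : countType) (X : S -> I) (A : I -> set S) :
  measurable_fibers X -> (forall v, measurable (A v)) ->
  measurable [set s | A (X s) s].
Proof.
move=> mX mA; rewrite (_ : [set _ | _] = \bigcup_v (X @^-1` [set v] `&` A v)).
  by apply: countable_bigcupT_measurable => // v; exact: measurableI.
by apply/seteqP; split=> [s As|s [v _ [/= <-]]//]; exists (X s).
Qed.

Lemma measurable_fibers_comp (I J : countType) (X : S -> I) (F : I -> S -> J) :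
  measurable_fibers X -> (forall v, measurable_fibers (F v)) ->
  measurable_fibers (fun s => F (X s) s).
Proof.
by move=> mX mF v; exact: (measurable_fibers_case _ X (fun u => F u @^-1` [set v]) mX (mF^~ v)).
Qed.

Lemma measurable_fibers_cst (I : Type) (v : I) : measurable_fibers (fun=> v).
Proof. by move=> u; rewrite preimage_cst; case: ifP. Qed.

Lemma measurable_fibers_if (I : Type) (b : S -> bool) (u v : I) :
  measurable_fun setT b -> measurable_fibers (fun s => if b s then u else v).
Proof.
move=> mb w.
have mcst (Q : Prop) : measurable [set _ : S | Q].
  have [q|q] := pselect Q.
    by rewrite (_ : mkset _ = setT)//; apply/seteqP; split.
  by rewrite (_ : mkset _ = set0)//; apply/seteqP; split.
have mbe e : measurable (b @^-1` [set e]) by rewrite -[X in measurable X]setTI; exact: mb.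
rewrite (_ : _ @^-1` _ = (b @^-1` [set true] `&` [set _ | u = w]) `|`
                         (b @^-1` [set false] `&` [set _ | v = w])).
  by apply: measurableU; exact: measurableI.
by apply/seteqP; split=> s /=; case: (b s) => //=; [left|right|case=> -[]..].
Qed.

Lemma measurable_fun_fibers (I : countType) d' (U : measurableType d')
    (X : S -> I) (f : I -> S -> U) :
  measurable_fibers X -> (forall v, measurable_fun setT (f v)) ->
  measurable_fun setT (fun s => f (X s) s).
Proof.
move=> mX mf _ B mB; rewrite setTI.
apply: (measurable_fibers_case _ X (fun u => f u @^-1` B) mX) => v.
by rewrite -[X in measurable X]setTI; exact: mf.
Qed.

Lemma measurable_fibers_argmax_first (R : realType) k (F : nat -> S -> R) :
  (forall i, measurable_fun setT (F i)) ->
  measurable_fibers (fun s => argmax_first k (F^~ s)).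
Proof.
move=> mF; rewrite /argmax_first.
(* The accumulator of the fold is itself random, so the induction allows an arbitrary discrete start
   [X]. *)
suff aux l X : measurable_fibers X -> measurable_fibers (fun s =>
    foldl (fun b i => if F b s < F i s then i else b) (X s) l).
  by apply: (aux _ (fun=> 0%N)); exact: measurable_fibers_cst.
elim: l X => [X mX|i l ih X mX] /=; first exact: mX.
pose X' s := if F (X s) s < F i s then i else X s.
apply: (ih X'); rewrite /X' => {X'}.
apply: (measurable_fibers_comp _ _ X (fun b s => if F b s < F i s then i else b) mX) => b.
by apply: measurable_fibers_if; exact: measurable_fun_ltr.
Qed.

End DiscreteMeasurability.

(** * The first maximiser of a finite family *)

Section Argmax.
Context {R : realType}.
Implicit Types (F : nat -> R).

Lemma argmax_first_lt k F : (0 < k)%N -> (argmax_first k F < k)%N.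
Proof.
case: k => // k _; rewrite /argmax_first /=.
suff aux l b : (b < k.+1)%N -> all (fun i => i < k.+1)%N l ->
    (foldl (fun b i => if (F b < F i)%R then i else b) b l < k.+1)%N.
  by apply: aux => //; apply/allP => i; rewrite mem_iota add1n => /andP[].
elim: l b => //= i l ih b bk /andP[ik lk].
by apply: ih => //; case: ifP.
Qed.

Lemma argmax_first_max k F i : (i < k)%N -> F i <= F (argmax_first k F).
Proof.
case: k => // k ik; rewrite /argmax_first /=.
have : i \in 0%N :: iota 1 k by rewrite (_ : _ :: _ = iota 0 k.+1)// mem_iota.
suff aux l b : F b <= F (foldl (fun b i => if F b < F i then i else b) b l) /\
    (forall j, j \in l -> F j <= F (foldl (fun b i => if F b < F i then i else b) b l)).
  by rewrite inE => /predU1P[->|]; [exact: (aux _ _).1|exact: (aux _ _).2].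
elim: l b => [|a l ih] b /=; first by rewrite lexx.
set b' := if _ then _ else _; have [b'l jl] := ih b'.
have [bb' ab'] : F b <= F b' /\ F a <= F b'.
  by rewrite /b'; case: ltP => [/ltW|]; rewrite lexx.
split; first exact: le_trans b'l.
by move=> j; rewrite inE => /predU1P[->|/jl//]; exact: le_trans b'l.
Qed.

End Argmax.

(** * Histories: pull counts, and dependence on past rewards only *)

Section Histories.
Context {R : realType}.
Variable k : nat.
Hypothesis k0 : (0 < k)%N.
Implicit Types (Y : nat -> nat -> R).

Lemma size_ucb_hist Y t : size (ucb_hist k Y t) = t.
Proof. by elim: t => //= t ih; rewrite size_rcons ih. Qed.

Lemma ucb_histS Y t : ucb_hist k Y t.+1 = rcons (ucb_hist k Y t) (ucb_action k Y t.+1).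
Proof. by []. Qed.

Lemma nth_ucb_hist Y t s : (s < t)%N -> nth 0%N (ucb_hist k Y t) s = ucb_action k Y s.+1.
Proof.
elim: t => // t ih; rewrite ltnS ucb_histS nth_rcons size_ucb_hist leq_eqVlt.
by case: ltngtP => //= [/ih//|->].
Qed.

Lemma ucb_action_lt Y t : (ucb_action k Y t < k)%N.
Proof.
rewrite /ucb_action /ucb_choose; case: ifP => [tk|_]; last exact: argmax_first_lt.
by case: t tk.
Qed.

Lemma pulls_ucb_histE Y t i :
  pulls (ucb_hist k Y t) i = (\sum_(0 <= s < t) (ucb_action k Y s.+1 == i))%N.
Proof.
elim: t => [|t ih]; first by rewrite big_geq.
by rewrite big_nat_recr// -ih /pulls ucb_histS -cats1 count_cat /= addn0.
Qed.

Lemma pulls_ucb_histS Y t i :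
  pulls (ucb_hist k Y t.+1) i = (pulls (ucb_hist k Y t) i + (ucb_action k Y t.+1 == i))%N.
Proof. by rewrite !pulls_ucb_histE big_nat_recr. Qed.

Lemma pulls_ucb_hist_gt0 Y t i : (i < k)%N -> (k <= t)%N -> (0 < pulls (ucb_hist k Y t) i)%N.
Proof.
(* Arm [i] is pulled at time [i + 1] of the initial round. *)
move=> ik kt; rewrite pulls_ucb_histE (big_cat_nat _ (n := i.+1))//=; last exact: leq_trans kt.
by rewrite big_nat_recr//= {2}/ucb_action /ucb_choose ik eqxx addn1.
Qed.

Lemma mean_hat_ucb_histE Y t i : (0 < pulls (ucb_hist k Y t) i)%N ->
  mean_hat Y (ucb_hist k Y t) i =
  (\sum_(0 <= s < t) (if ucb_action k Y s.+1 == i then Y i s.+1 else 0))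
    / (pulls (ucb_hist k Y t) i)%:R.
Proof.
move=> N0; rewrite /mean_hat (gtn_eqF N0) size_ucb_hist big_mkord.
by congr (_ / _); apply: eq_bigr => s _; rewrite nth_ucb_hist.
Qed.

Lemma ucb_action_max Y t i : (k <= t)%N -> (i < k)%N ->
  ucb_index Y (ucb_hist k Y t) t.+1 i <=
  ucb_index Y (ucb_hist k Y t) t.+1 (ucb_action k Y t.+1).
Proof.
move=> kt ik; rewrite /ucb_action /ucb_choose leqNgt ltnS kt /=.
exact: argmax_first_max.
Qed.

Lemma ucb_choose_eq Y Y' t h : (forall i s, (0 < s <= size h)%N -> Y i s = Y' i s) ->
  ucb_choose k Y t h = ucb_choose k Y' t h.
Proof.
move=> YY'; rewrite /ucb_choose; case: ifP => // _; congr argmax_first.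
apply/funext => i; rewrite /ucb_index /mean_hat; case: ifP => // _.
congr (_ / _ + _); apply: eq_bigr => s _; case: ifP => // _.
by rewrite YY'//= ltn_ord.
Qed.

(** The action at time [t] is chosen before the reward at time [t] is seen, whence the strict bound
    on [s]. This is the source of the predictability of the weights. *)
Lemma ucb_hist_eq Y Y' t : (forall i s, (0 < s < t)%N -> Y i s = Y' i s) ->
  ucb_hist k Y t = ucb_hist k Y' t.
Proof.
elim: t => //= t ih YY'.
have -> : ucb_hist k Y t = ucb_hist k Y' t.
  by apply: ih => i s /andP[s0 st]; apply: YY'; rewrite s0 ltnW.
congr rcons; apply: ucb_choose_eq => i s; rewrite size_ucb_hist => /andP[s0 st].
by apply: YY'; rewrite s0.
Qed.

End Histories.

(** * UCB as a function of the reward table *)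

Section TableMeasurability.
Context {R : realType}.
Variables (k T : nat).

Lemma measurable_table i t : measurable_fun setT (fun ys : seqM R => table T ys i t).
Proof. exact: measurable_nth. Qed.

Lemma measurable_ucb_index h t i :
  measurable_fun setT (fun ys : seqM R => ucb_index (table T ys) h t i).
Proof.
apply: measurable_funD => //; rewrite /mean_hat; case: (pulls h i == 0%N) => //.
apply: measurable_funM => //; apply: measurable_sum => s.
by case: (nth 0%N h s == i) => //; exact: measurable_table.
Qed.

Lemma measurable_fibers_ucb_choose t h :
  measurable_fibers (fun ys : seqM R => ucb_choose k (table T ys) t h).
Proof.
rewrite /ucb_choose; case: (t <= k)%N; first exact: measurable_fibers_cst.
apply: (measurable_fibers_argmax_first R k (fun i (ys : seqM R) => ucb_index (table T ys) h t i)).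
exact: measurable_ucb_index.
Qed.

Lemma measurable_fibers_ucb_hist t :
  measurable_fibers (fun ys : seqM R => ucb_hist k (table T ys) t).
Proof.
elim: t => [|t ih] /=; first exact: measurable_fibers_cst.
apply: (measurable_fibers_comp _ _ _
  (fun h (ys : seqM R) => rcons h (ucb_choose k (table T ys) t.+1 h)) ih) => h.
apply: (measurable_fibers_comp _ _ _ (fun a (_ : seqM R) => rcons h a)
  (measurable_fibers_ucb_choose t.+1 h)) => a.
exact: measurable_fibers_cst.
Qed.

Lemma measurable_fun_ucb_hist d' (U : measurableType d') (f : seq nat -> U) t :
  measurable_fun setT (fun ys : seqM R => f (ucb_hist k (table T ys) t)).
Proof.
apply: (measurable_fun_fibers _ _ _ _ (fun h (_ : seqM R) => f h)
  (measurable_fibers_ucb_hist t)) => h.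
exact: measurable_cst.
Qed.

(** Position [i * T + j] holds the reward of arm [i] at time [j + 1]. Reduction modulo [T] recovers
    the time, so a change there leaves the earlier rewards of all arms intact. *)
Lemma table_set_nth ys i i' j t x : (j < T)%N -> (0 < t <= j)%N ->
  table T (set_nth 0 ys (i * T + j) x) i' t = table T ys i' t :> R.
Proof.
move=> jT /andP[t0 tj]; rewrite /table nth_set_nth /=.
have tj1 : (t.-1 < j)%N by rewrite prednK.
case: eqP => // /(congr1 (modn^~ T)).
rewrite !modnMDl !modn_small ?(ltn_trans tj1)// => tjE.
by rewrite tjE ltnn in tj1.
Qed.

Lemma ucb_hist_set_nth (ys : seq R) i j s x : (j < T)%N -> (s <= j)%N ->
  ucb_hist k (table T (set_nth 0 ys (i * T + j) x)) s.+1 = ucb_hist k (table T ys) s.+1.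
Proof.
move=> jT sj; apply: ucb_hist_eq => i' t /andP[t0 ts].
by apply: table_set_nth; rewrite // t0 (leq_trans _ sj).
Qed.

End TableMeasurability.

(** * Numerical bounds *)

Section Numerics.
Context {R : realType}.

(** A geometric sum: by [1 + c <= expR c], its [s]-th term is at most the increment of
    [(1 - expR (- (s%:R * c))) / c], and these increments telescope. *)
Lemma sum_expRN_le (c : R) n : 0 < c ->
  \sum_(1 <= s < n) expR (- (s%:R * c)) <= c^-1.
Proof.
move=> c0.
suff aux l : \sum_(1 <= s < l.+1) expR (- (s%:R * c)) <= (1 - expR (- (l%:R * c))) / c.
  case: n => [|n]; first by rewrite big_geq// invr_ge0 ltW.
  apply: le_trans (aux n) _; rewrite ler_pdivrMr// mulVf ?gt_eqF//.
elim: l => [|l ih]; first by rewrite big_geq// mul0r oppr0 expR0 subrr mul0r.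
rewrite big_nat_recr//= -[leRHS](subrK ((1 - expR (- (l%:R * c))) / c)) addrC.
apply: lerD => //; rewrite -mulrBl ler_pdivlMr//.
rewrite (_ : - (l%:R * c) = c + - (l.+1%:R * c)); last by rewrite -natr1; ring.
rewrite expRD; set e := expR (- _).
have := expR_ge1Dx c; have : 0 <= e by exact: expR_ge0.
move=> e0 cE; have := ler_wpM2r e0 cE; lra.
Qed.

Lemma ln2_ge : 2^-1 <= ln 2 :> R.
Proof.
have := @le_ln1Dx R (- 2^-1); rewrite (_ : 1 + - 2^-1 = 2^-1); last by lra.
by rewrite lnV ?posrE// => /(_ _)/wrap[]; lra.
Qed.

Lemma flog_ge1 t : 1 <= flog R t.
Proof. by rewrite lerDl mulr_ge0// sqr_ge0. Qed.

Lemma ln_flog_ge0 t : 0 <= ln (flog R t).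
Proof. by rewrite ln_ge0// flog_ge1. Qed.

Lemma ler_flog s t : (0 < s)%N -> (s <= t)%N -> flog R s <= flog R t.
Proof.
move=> s0 st; rewrite lerD2l ler_pM ?sqr_ge0 ?ler_nat//.
have ln0 n : (0 < n)%N -> 0 <= ln (n%:R : R) by move=> n0; rewrite ln_ge0// ler1n.
rewrite ler_sqr ?nnegrE ?ln0 ?(leq_trans s0)//.
by rewrite ler_ln ?posrE ?ltr0n ?(leq_trans s0)// ler_nat.
Qed.

(** For [n >= 3], 1 / f(n) <= 1 / (n ln^2 n) <= 1 / ln (n - 1) - 1 / ln n, which telescopes. The
    first term 1 / f(2) is at most 1 and 1 / ln 2 is at most 2, whence 3. *)
Lemma sum_flogV_le n : \sum_(1 <= t < n) (flog R t.+1)^-1 <= 3.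
Proof.
have lnge t : (2 <= t)%N -> 2^-1 <= ln (t%:R : R).
  move=> t2; apply: le_trans ln2_ge _; rewrite ler_ln ?posrE ?ltr0n ?(ltnW t2)//.
  by rewrite ler_nat.
suff aux l : \sum_(1 <= t < l.+2) (flog R t.+1)^-1 <= 3 - (ln (l.+2%:R : R))^-1.
  case: n => [|[|n]]; [by rewrite big_geq|by rewrite big_geq|].
  apply: le_trans (aux n) _; rewrite lerBlDr lerDl invr_ge0; have := lnge n.+2 isT; lra.
elim: l => [|l ih].
  rewrite big_nat1.
  have : (flog R 2)^-1 <= 1 by rewrite invf_le1 ?flog_ge1// (lt_le_trans _ (flog_ge1 2)).
  have : (ln (2 : R))^-1 <= 2 by rewrite invf_ple ?posrE//; have := ln2_ge; lra.
  lra.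
rewrite big_nat_recr//=; set a := ln (l.+2%:R : R) in ih *; set b := ln (l.+3%:R : R).
have a0 : 0 < a by have := lnge l.+2 isT; rewrite -/a; lra.
have b0 : 0 < b by have := lnge l.+3 isT; rewrite -/b; lra.
suff : (flog R l.+3)^-1 <= a^-1 - b^-1 by move: ih; lra.
have ab : l.+3%:R^-1 <= b - a.
  have := @le_ln1Dx R (- l.+3%:R^-1).
  rewrite (_ : 1 + - l.+3%:R^-1 = l.+2%:R / l.+3%:R); last first.
    by rewrite -[l.+2%:R](addrK 1) natr1 mulrBl divff ?pnatr_eq0// mul1r.
  rewrite ln_div ?posrE ?ltr0n// -/a -/b.
  move=> /(_ _)/wrap[]; last by rewrite lerNr opprB.
  by rewrite ltrN2 invf_lt1 ?ltr0n// ltr1n.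
have n0 : 0 < l.+3%:R :> R by rewrite ltr0n.
have ab1 : a <= b by rewrite -subr_ge0 (le_trans _ ab)// invr_ge0 ltW.
apply: (@le_trans _ _ (l.+3%:R * b ^+ 2)^-1).
  by rewrite lef_pV2 ?posrE ?(lt_le_trans ltr01 (flog_ge1 _)) ?mulr_gt0 ?exprn_gt0// /flog -/b lerDr.
rewrite (_ : a^-1 - b^-1 = (b - a) / (a * b)); last by field; rewrite !gt_eqF.
rewrite invfM; apply: ler_pM => //; rewrite ?invr_ge0 ?exprn_ge0 ?(ltW n0) ?(ltW b0)//.
by rewrite lef_pV2 ?posrE ?mulr_gt0// expr2 ler_wpM2r// ltW.
Qed.

(** Once ln t exceeds 1, f(t) >= t ln^2 t >= t. The alternative serves to absorb a multiple of ln T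
    in the final numerical comparison. *)
Lemma ln_le1_or_le_ln_flog t : (0 < t)%N ->
  ln (t%:R : R) <= 1 \/ ln (t%:R : R) <= ln (flog R t).
Proof.
move=> t0; case: (lerP (ln (t%:R : R)) 1) => [|/ltW ln1]; [by left|right].
have t0' : 0 < t%:R :> R by rewrite ltr0n.
rewrite ler_ln ?posrE ?(lt_le_trans ltr01 (flog_ge1 _))//.
rewrite /flog -[leLHS]add0r lerD// ler_peMr ?(ltW t0')//.
by rewrite expr_ge1// (le_trans ler01).
Qed.

End Numerics.

(** * Counting pulls along a trajectory *)

Section PathwiseBound.
Context {R : realType}.
Variables (k T : nat).
Hypothesis k0 : (0 < k)%N.
Implicit Types (ys : seq R).

(** Times are counted from 0 here: [act ys t] is the action at time [t + 1], chosen from the history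
    of length [t], and [pos i t] is the place of the reward of arm [i] at that time. *)
Let act ys t := ucb_action k (table T ys) t.+1.
Let pos i t := (i * T + t)%N.

Definition played i t ys : bool := act ys t == i.
Definition played_early i s t ys : bool :=
  played i t ys && (pulls (ucb_hist k (table T ys) t) i < s)%N.

Lemma pulls_playedE i t ys :
  pulls (ucb_hist k (table T ys) t) i = (\sum_(0 <= r < t) played i r ys)%N.
Proof. exact: pulls_ucb_histE. Qed.

Lemma sum_played_early i s n ys :
  (\sum_(0 <= t < n) played_early i s t ys)%N =
  minn s (pulls (ucb_hist k (table T ys) n) i).
Proof.
elim: n => [|n ih]; first by rewrite big_geq// minn0.
rewrite big_nat_recr//= ih pulls_ucb_histS /played_early /played.
case: eqP => /= _; last by rewrite !addn0.
rewrite addn1; case: (ltnP (pulls (ucb_hist k (table T ys) n) i) s) => h /=; lia.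
Qed.

(** Each play raises the pull count by one, so a given count [s] is met at no more than one play.
    This turns sums over times into sums over pull counts. *)
Lemma sum_played_at i s n ys :
  (\sum_(0 <= t < n) (played i t ys && (pulls (ucb_hist k (table T ys) t) i == s)))%N =
  (s < pulls (ucb_hist k (table T ys) n) i)%N.
Proof.
elim: n => [|n ih]; first by rewrite big_geq.
rewrite big_nat_recr//= ih pulls_ucb_histS /played.
case: eqP => /= _; last by rewrite !addn0.
by case: eqP => h; case: ltnP; case: ltnP => /=; lia.
Qed.

(** Expresses [played] through the history, whose measurability and non-anticipation are established
    above. *)
Lemma played_lastE i t ys :
  played i t ys = (last 0%N (ucb_hist k (table T ys) t.+1) == i).
Proof. by rewrite ucb_histS last_rcons. Qed.

Lemma measurable_played i t : measurable_fun setT (played i t : seqM R -> bool).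
Proof.
rewrite (_ : played i t = (fun ys => last 0%N (ucb_hist k (table T ys) t.+1) == i)); last first.
  by apply/funext => ys; exact: played_lastE.
exact: (measurable_fun_ucb_hist _ _ _ _ (fun h => last 0%N h == i)).
Qed.

Lemma measurable_played_early i s t :
  measurable_fun setT (played_early i s t : seqM R -> bool).
Proof.
apply: measurable_and; first exact: measurable_played.
exact: (measurable_fun_ucb_hist _ _ _ _ (fun h => pulls h i < s)%N).
Qed.

Lemma played_set_nth i j s t ys x : (t < T)%N -> (s <= t)%N ->
  played i s (set_nth 0 ys (pos j t) x) = played i s ys.
Proof.
by move=> tT st; rewrite !played_lastE ucb_hist_set_nth.
Qed.

Lemma pulls_set_nth i j s t ys x : (t < T)%N -> (s <= t)%N ->
  pulls (ucb_hist k (table T (set_nth 0 ys (pos j t) x)) s) i =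
  pulls (ucb_hist k (table T ys) s) i.
Proof.
move=> tT st; rewrite !pulls_playedE; apply: eq_big_nat => r /andP[_ rs].
by rewrite played_set_nth// ltnW// (leq_trans rs).
Qed.

Lemma played_early_set_nth i j n s t ys x : (t < T)%N -> (s <= t)%N ->
  played_early i n s (set_nth 0 ys (pos j t) x) = played_early i n s ys.
Proof.
by move=> tT st; rewrite /played_early played_set_nth// pulls_set_nth.
Qed.

(* The two ways in which UCB can err: the index of the best arm [a] is below
   [mu - h] after [s] pulls, or arm [i] has mean above [mu + h / 2] after [s]
   pulls.  The weights [played_early i s] stop the sum at the [s]-th pull, which
   avoids a union bound over the time at which that pull occurs. *)
Definition underestimated (mu h : R) a t s ys : bool :=
  deviates (pos a) (played a) mu (- (h + Num.sqrt (2 * ln (flog R t.+1) / s%:R))) t s ys.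

Definition overestimated (mu h : R) i s ys : bool :=
  deviates (pos i) (played_early i s) mu (h / 2) T s ys.

Lemma mean_hat_playedE i t ys : (0 < pulls (ucb_hist k (table T ys) t) i)%N ->
  mean_hat (table T ys) (ucb_hist k (table T ys) t) i =
  (\sum_(0 <= s < t) (if played i s ys then nth 0 ys (pos i s) else 0))
    / (pulls (ucb_hist k (table T ys) t) i)%:R.
Proof. exact: mean_hat_ucb_histE. Qed.

Lemma sum_centered i mu t ys :
  \sum_(0 <= s < t) (if played i s ys then nth 0 ys (pos i s) - mu else 0) =
  \sum_(0 <= s < t) (if played i s ys then nth 0 ys (pos i s) else 0)
    - (pulls (ucb_hist k (table T ys) t) i)%:R * mu.
Proof.
rewrite pulls_playedE natr_sum mulr_suml -sumrB; apply: eq_bigr => s _.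
by case: ifP => _; rewrite ?mul1r// mul0r subr0.
Qed.

Lemma underestimatedP mu h a t ys : 0 <= h -> (a < k)%N -> (k <= t)%N ->
  ucb_index (table T ys) (ucb_hist k (table T ys) t) t.+1 a <= mu - h ->
  underestimated mu h a t (pulls (ucb_hist k (table T ys) t) a) ys.
Proof.
move=> h0 ak kt; have N0 := pulls_ucb_hist_gt0 k (table T ys) t a ak kt.
rewrite /ucb_index mean_hat_playedE// /underestimated /deviates -pulls_playedE eqxx /=.
rewrite sum_centered; set N := pulls _ _; set S := \sum_(0 <= s < t) _; set q := Num.sqrt _.
move=> idx; have q0 : 0 <= q by exact: sqrtr_ge0.
have N0' : 0 < N%:R :> R by rewrite ltr0n.
(* The empirical mean is at most [mu - h - q]; multiplying by [h + q], the negative of [lam], gives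
   the deviation. *)
have : S <= (mu - h - q) * N%:R by rewrite -ler_pdivrMr//; move: idx; lra.
move=> SN; have x0 : 0 <= h + q by rewrite addr_ge0.
have : 0 <= (mu - h - q) * N%:R - S by rewrite subr_ge0.
by move=> /(mulr_ge0 x0); lra.
Qed.

Lemma overestimatedP mu h i t s ys : 0 <= h -> (t < T)%N -> (0 < s)%N ->
  played i t ys -> pulls (ucb_hist k (table T ys) t) i = s ->
  mu + h / 2 <= mean_hat (table T ys) (ucb_hist k (table T ys) t) i ->
  overestimated mu h i s ys.
Proof.
move=> h0 tT s0 it Ns; rewrite mean_hat_playedE Ns// => mean; have tT1 := ltnW tT.
(* The count [s] is reached exactly at [t]: plays before [t] are all early, and none from [t] on is.
   Hence the sum up to the fixed horizon [T] equals the sum up to [t]. *)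
have split_sum (V : nmodType) (F : nat -> V) :
    \sum_(0 <= r < T) (if played_early i s r ys then F r else 0) =
    \sum_(0 <= r < t) (if played i r ys then F r else 0).
  rewrite (big_cat_nat (n := t))//= [X in _ + X]big_nat_cond [X in _ + X]big1 ?addr0.
    apply: eq_big_nat => r /andP[_ rt]; rewrite /played_early.
    case: (boolP (played i r ys)) => //= ir; rewrite ifT// -Ns.
    rewrite [leqRHS]pulls_playedE (big_cat_nat (n := r.+1))//= -pulls_playedE.
    by rewrite pulls_ucb_histS -/(act ys r) -/(played i r ys) ir addn1 leq_addr.
  move=> r /andP[/andP[tr _] _]; rewrite /played_early ltnNge (_ : (s <= _)%N) ?andbF//.
  by rewrite -Ns !pulls_playedE [leqRHS](big_cat_nat (n := t))//= leq_addr.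
rewrite /overestimated /deviates sum_played_early; apply/andP; split.
  apply/eqP/minn_idPl; rewrite -Ns !pulls_playedE.
  by rewrite [leqRHS](big_cat_nat (n := t))//= leq_addr.
rewrite (split_sum _ (fun r => nth 0 ys (pos i r) - mu)) sum_centered Ns.
have s0' : 0 < s%:R :> R by rewrite ltr0n.
rewrite expr2 -mulrA; apply: ler_wpM2l; first lra.
by move: mean; rewrite ler_pdivlMr//; lra.
Qed.

Lemma pulls_le i t ys : (pulls (ucb_hist k (table T ys) t) i <= t)%N.
Proof. by rewrite -[leqRHS](size_ucb_hist k (table T ys) t) /pulls count_size. Qed.

(** The term 1 is the initial round. Each later play of [i] is charged either to an underestimate of
    [a] at that time, or to the current pull count [s] of [i]; each [s] is charged at most once, so
    the last sum does not run over times. *)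
Lemma pulls_bound (mui mua h : R) i a ys : 0 < h -> (i < k)%N -> (a < k)%N ->
  mua - mui = 2 * h ->
  (pulls (ucb_hist k (table T ys) T) i <=
   1 + (\sum_(k <= t < T) \sum_(1 <= s < T) underestimated mua h a t s ys)
     + \sum_(1 <= s < T) ((s%:R < 8 * ln (flog R T) / h ^+ 2)%R + overestimated mui h i s ys))%N.
Proof.
move=> h0 ik ak gap; have hge0 := ltW h0.
pose N t := pulls (ucb_hist k (table T ys) t) i.
(* With [s] pulls the bonus is at most [h / 2] as soon as [s >= 8 ln f(T) / h^2]. *)
pose small s := (s%:R < 8 * ln (flog R T) / h ^+ 2)%R.
have step t : (k <= t < T)%N -> (played i t ys <=
    \sum_(1 <= s < T) underestimated mua h a t s ys +
    \sum_(1 <= s < T) (played i t ys && (N t == s)) * (small s + overestimated mui h i s ys))%N.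
  move=> /andP[kt tT]; case: (boolP (played i t ys)) => //= it.
  have T0 : (0 < T)%N by exact: leq_ltn_trans tT.
  have [idx|idx] := lerP (ucb_index (table T ys) (ucb_hist k (table T ys) t) t.+1 a) (mua - h).
    have Na := pulls_ucb_hist_gt0 k (table T ys) t a ak kt.
    have NaT := leq_ltn_trans (pulls_le a t ys) tT.
    rewrite (bigD1_seq (pulls (ucb_hist k (table T ys) t) a)) ?iota_uniq//=; last first.
      by rewrite mem_index_iota Na NaT.
    by rewrite underestimatedP// -addnA leq_addr.
  have Ni := pulls_ucb_hist_gt0 k (table T ys) t i ik kt.
  have NiT := leq_ltn_trans (pulls_le i t ys) tT.
  rewrite [X in (_ + X)%N](bigD1_seq (N t)) ?iota_uniq//=; last first.
    by rewrite mem_index_iota Ni NiT.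
  rewrite eqxx mul1n; suff : small (N t) || overestimated mui h i (N t) ys.
    by case: (small _) => //=; [lia|move=> ->; lia].
  case: (boolP (small (N t))) => //=; rewrite /small -leNgt => sN.
  apply: (overestimatedP mui h i t) => //.
  (* Arm [i] was chosen, so its index exceeds [mua - h = mui + h]; a bonus of at most [h / 2] leaves
     an empirical mean above [mui + h / 2]. *)
  have := ucb_action_max k (table T ys) t a kt ak; rewrite -/(act ys t) (eqP it).
  move=> /(lt_le_trans idx); rewrite [X in _ < X]/ucb_index => mean.
  suff : Num.sqrt (2 * ln (flog R t.+1) / (pulls (ucb_hist k (table T ys) t) i)%:R) <= h / 2.
    by move: mean gap; lra.
  have N0 : 0 < (N t)%:R :> R by rewrite ltr0n.
  rewrite -(ler_sqr (x := Num.sqrt _)) ?nnegrE ?sqrtr_ge0//; last by rewrite divr_ge0 ?ltW.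
  rewrite sqr_sqrtr; last by rewrite divr_ge0 ?ler0n// mulr_ge0// ln_flog_ge0.
  rewrite ler_pdivrMr//; move: sN; rewrite ler_pdivrMr ?exprn_gt0//.
  have : ln (flog R t.+1) <= ln (flog R T).
    by rewrite ler_ln ?posrE ?(lt_le_trans ltr01 (flog_ge1 _))// ler_flog.
  by rewrite -/(N t); lra.
(* In the initial round index [t] plays arm [t], so arm [i] is played at most once. *)
have sum_eq n : (\sum_(0 <= t < n) (t == i) <= 1)%N.
  have -> : (\sum_(0 <= t < n) (t == i) = (i < n))%N; last by case: (_ < _)%N.
  elim: n => [|n ih]; first by rewrite big_geq.
  by rewrite big_nat_recr//= ih; case: (ltngtP i n) => //=; lia.
have initial n : (n <= k)%N -> (\sum_(0 <= t < n) played i t ys <= 1)%N.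
  move=> nk; apply: leq_trans (sum_eq n); rewrite big_nat_cond [leqRHS]big_nat_cond.
  apply: leq_sum => t /andP[/andP[_ tn] _].
  by rewrite /played /act /ucb_action /ucb_choose (leq_trans tn).
rewrite pulls_playedE; have [Tk|kT] := leqP T k.
  by rewrite -addnA (leq_trans (initial _ Tk))// leq_addr.
rewrite (big_cat_nat (n := k)) ?(ltnW kT)//= -addnA leq_add ?initial//.
have step_sum : (\sum_(k <= t < T) played i t ys <= \sum_(k <= t < T)
    (\sum_(1 <= s < T) underestimated mua h a t s ys +
     \sum_(1 <= s < T) (played i t ys && (N t == s)) * (small s + overestimated mui h i s ys)))%N.
  by rewrite big_nat_cond [leqRHS]big_nat_cond; apply: leq_sum => t /andP[/step].
apply: leq_trans step_sum _.
(* After the exchange, the inner sum over times is at most 1 for each pull count [s]. *)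
rewrite big_split/= leq_add2l exchange_big/=; apply: leq_sum => s _.
rewrite -big_distrl/= -[leqRHS]mul1n leq_mul2r; apply/orP; right.
have := sum_played_at i s T ys; rewrite (big_cat_nat (n := k)) ?(ltnW kT)//=.
by rewrite /N => h'; case: (_ < _)%N h' => /= h'; lia.
Qed.

End PathwiseBound.

(** * Regret for fixed means *)

Lemma sum_small_le (R : realType) (u : R) n : 0 <= u ->
  \sum_(1 <= s < n) ((s%:R < u :> R)%:R : R) <= u.
Proof.
move=> u0; case: n => [|n]; first by rewrite big_geq.
elim: n => [|n ih]; first by rewrite big_geq.
rewrite big_nat_recr//=; case: ltrP => [nu|_]; last by rewrite addr0.
apply: le_trans (ltW nu); rewrite -natr1 lerD2r.
apply: le_trans (_ : \sum_(1 <= s < n.+1) 1 <= _).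
  by apply: ler_sum => s _; case: (_ < _).
by rewrite sumr_const_nat subSS subn0.
Qed.

Lemma ler_sum_nat_widen (R : realType) (F : nat -> R) k n : (0 < k)%N ->
  (forall t, 0 <= F t) -> \sum_(k <= t < n) F t <= \sum_(1 <= t < n) F t.
Proof.
move=> k0 F0; have [nk|kn] := leqP n k; first by rewrite big_geq// sumr_ge0.
by rewrite [leRHS](big_cat_nat (n := k)) ?(ltnW kn)//= lerDr sumr_ge0.
Qed.

Lemma bigmax_nth (R : realType) (m : seq R) k : (0 < k)%N ->
  exists a, [/\ (a < k)%N, \big[Num.max/nth 0 m 0]_(i < k) nth 0 m i = nth 0 m a &
    forall i, (i < k)%N -> nth 0 m i <= nth 0 m a].
Proof.
move=> k0; set M := \big[_/_]_(_ < _) _.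
have [a ak Ma] : exists2 a, (a < k)%N & M = nth 0 m a.
  (* The default [nth 0 m 0] of the maximum is the mean of arm 0, an arm since [k] is positive. *)
  rewrite /M; elim/big_ind: _; [by exists 0%N| |by move=> i _; exists i].
  move=> _ _ [a ak ->] [b bk ->].
  by rewrite maxEle; case: ifP => _; [exists b|exists a].
exists a; split => // i ik; rewrite -Ma.
exact: (le_bigmax _ (fun i : 'I_k => nth 0 m i) (Ordinal ik)).
Qed.

(* A bound on [d * E N_i] for an arm [i] of gap [d], with cut-off [c]. *)
Definition gap_cost (R : realType) (c C : R) (T : nat) (d : R) : R :=
  if d <= 0 then 0 else if d <= c then T%:R * c else 1 + C / d.

Lemma gap_cost_ge0 (R : realType) (c C : R) T d : 0 <= c -> 0 <= C ->
  0 <= gap_cost R c C T d.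
Proof.
move=> c0 C0; rewrite /gap_cost; case: ifPn => // d0; case: ifP => _; first exact: mulr_ge0.
by rewrite addr_ge0// divr_ge0// ltW// ltNge.
Qed.

Section Frequentist.
Context {R : realType}.
Variables (k T : nat) (P : R -> probability R R) (m : seq R).
Hypothesis k0 : (0 < k)%N.
Hypothesis m01 : forall i, (i < k)%N -> 0 <= nth 0%R m i <= 1.
Hypothesis subgaussian : forall i, (i < k)%N -> forall s : R,
  (\int[P (nth 0%R m i)]_x (expR (s * (x - nth 0%R m i)))%:E <= (expR (s ^+ 2 / 2))%:E)%E.

Let laws := reward_laws P k T m.
Let L := ln (flog R T).

Lemma size_reward_laws : size laws = (k * T)%N.
Proof. by rewrite size_map size_iota. Qed.

Lemma nth_reward_laws mu0 i t : (i < k)%N -> (t < T)%N ->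
  nth mu0 laws (i * T + t) = P (nth 0%R m i).
Proof.
move=> ik tT; have T0 := leq_ltn_trans (leq0n t) tT; have lt : (i * T + t < k * T)%N by nia.
by rewrite (nth_map 0%N) ?size_iota// nth_iota// add0n divnMDl// divn_small// addn0.
Qed.

Lemma iint_deviates_arm (w : nat -> seq R -> bool) i (lam : R) n s : (i < k)%N -> (n <= T)%N ->
  (forall t, measurable_fun setT (w t : seqM R -> bool)) ->
  (forall r t ys x, (r <= t)%N -> (t < T)%N -> w r (set_nth 0 ys (i * T + t) x) = w r ys) ->
  (iint laws (fun ys => (deviates (fun t => i * T + t)%N w (nth 0%R m i) lam n s ys)%:R%:E)
   <= (expR (- (s%:R * lam ^+ 2 / 2)))%:E)%E.
Proof.
move=> ik nT mw wP.
apply: (iint_deviates laws (P 0) _ w T) => //.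
- by move=> t tT; rewrite size_reward_laws; nia.
- exact: addnI.
- by move=> t tn; rewrite nth_reward_laws ?(leq_trans tn)//; exact: subgaussian.
Qed.

(** With [lam = - (h + q)], dropping the cross term gives [s * lam ^+ 2 / 2 >= s * h ^+ 2 / 2 + s *
    q ^+ 2 / 2], and the bonus [q] is such that the last term is ln f(t + 1). The bound is thus
    summable in both [t] and [s]. *)
Lemma iint_underestimated (h : R) a t s : 0 <= h -> (a < k)%N -> (t < T)%N -> (0 < s)%N ->
  (iint laws (fun ys => (underestimated k T (nth 0%R m a) h a t s ys)%:R%:E) <=
   ((flog R t.+1)^-1 * expR (- (s%:R * (h ^+ 2 / 2))))%:E)%E.
Proof.
move=> h0 ak tT s0; apply: (@le_trans _ _ _ _ _ (iint_deviates_arm _ _ _ _ _ ak (ltnW tT) _ _)).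
- exact: measurable_played.
- by move=> r t' ys x rt t'T; rewrite played_set_nth.
rewrite lee_fin; set q := Num.sqrt _; have q0 : 0 <= q by exact: sqrtr_ge0.
have s0' : 0 < s%:R :> R by rewrite ltr0n.
have f0 : 0 < flog R t.+1 by exact: lt_le_trans ltr01 (flog_ge1 _).
have sq : s%:R * q ^+ 2 = 2 * ln (flog R t.+1).
  rewrite sqr_sqrtr; last by rewrite divr_ge0 ?ler0n// mulr_ge0// ln_flog_ge0.
  by rewrite mulrC divfK ?gt_eqF.
rewrite -[X in X^-1 * _](lnK (x := flog R t.+1)) ?posrE// -expRN -expRD ler_expR.
have : 0 <= s%:R * (h * q) by rewrite mulr_ge0 ?mulr_ge0// ltW.
move: sq; lra.
Qed.

Lemma iint_overestimated (h : R) i s : (i < k)%N ->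
  (iint laws (fun ys => (overestimated k T (nth 0%R m i) h i s ys)%:R%:E) <=
   (expR (- (s%:R * (h ^+ 2 / 8))))%:E)%E.
Proof.
move=> ik; apply: (@le_trans _ _ _ _ _ (iint_deviates_arm _ _ _ _ _ ik (leqnn T) _ _)).
- by move=> t; exact: measurable_played_early.
- by move=> r t' ys x rt t'T; rewrite played_early_set_nth.
by rewrite lee_fin ler_expR; lra.
Qed.

(** Underestimates contribute 3 * 2 / h^2 (the sum of 1 / f times a geometric sum), small pull
    counts [8 * L / h ^+ 2], and overestimates 8 / h^2; hence 14 = 6 + 8. *)
Lemma iint_pulls_le (h : R) i a : 0 < h -> (i < k)%N -> (a < k)%N ->
  nth 0%R m a - nth 0%R m i = 2 * h ->
  (iint laws (fun ys => (pulls (ucb_hist k (table T ys) T) i)%:R%:E) <=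
   (1 + (14 + 8 * L) / h ^+ 2)%:E)%E.
Proof.
move=> h0 ik ak gap; have hge0 := ltW h0.
pose u t s ys : \bar R := (underestimated k T (nth 0%R m a) h a t s ys)%:R%:E.
pose o s ys : \bar R := (overestimated k T (nth 0%R m i) h i s ys)%:R%:E.
pose small s : \bar R := (s%:R < 8 * L / h ^+ 2)%R%:R%:E.
have u0 t s ys : (0 <= u t s ys)%E by rewrite lee_fin ler0n.
have o0 s ys : (0 <= o s ys)%E by rewrite lee_fin ler0n.
have small0 s : (0 <= small s)%E by rewrite lee_fin ler0n.
have mu t s : measurable_fun setT (u t s : seqM R -> \bar R).
  apply: measurable_fun_EFin; apply: measurable_fun_natb; apply: measurable_deviates => r.
  exact: measurable_played.
have mo s : measurable_fun setT (o s : seqM R -> \bar R).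
  apply: measurable_fun_EFin; apply: measurable_fun_natb; apply: measurable_deviates => r.
  exact: measurable_played_early.
apply: (@le_trans _ _ (iint laws (fun ys => 1 +
    ((\sum_(k <= t < T) \sum_(1 <= s < T) u t s ys) +
     (\sum_(1 <= s < T) (small s + o s ys))))%E)).
  apply: le_iint => ys.
  have := pulls_bound k T k0 _ _ h i a ys h0 ik ak gap.
  rewrite -(ler_nat R) -lee_fin => /le_trans; apply.
  rewrite -addnA !natrD !EFinD natr_sum -sumEFin natr_sum -sumEFin.
  rewrite le_eqVlt; apply/orP; left; apply/eqP; congr (_ + (_ + _))%E.
    by apply: eq_bigr => t _; rewrite natr_sum -sumEFin.
  by apply: eq_bigr => s _; rewrite natrD EFinD.
have mU : measurable_fun setT
    ((fun ys => \sum_(k <= t < T) \sum_(1 <= s < T) u t s ys)%E : seqM R -> \bar R).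
  by apply: emeasurable_sum => t; exact: emeasurable_sum.
have mO : measurable_fun setT
    ((fun ys => \sum_(1 <= s < T) (small s + o s ys))%E : seqM R -> \bar R).
  by apply: emeasurable_sum => s; apply: emeasurable_funD.
rewrite iintD//; first last.
- exact: emeasurable_funD.
- by move=> ys; rewrite adde_ge0// sume_ge0// => t _; [exact: sume_ge0|rewrite adde_ge0].
rewrite iintD//; first last.
- by move=> ys; rewrite sume_ge0// => t _; rewrite adde_ge0.
- by move=> ys; rewrite sume_ge0// => t _; exact: sume_ge0.
rewrite iint_cst iint_sum//; first last.
- by move=> t; exact: emeasurable_sum.
- by move=> t ys; exact: sume_ge0.
rewrite iint_sum//; first last.
- by move=> t; exact: emeasurable_funD.
- by move=> t ys; rewrite adde_ge0.
rewrite EFinD leeD2lE//.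
apply: (@le_trans _ _ ((\sum_(k <= t < T) \sum_(1 <= s < T)
      (flog R t.+1)^-1 * expR (- (s%:R * (h ^+ 2 / 2)))) +
    (\sum_(1 <= s < T) ((s%:R < 8 * L / h ^+ 2)%R%:R + expR (- (s%:R * (h ^+ 2 / 8))))))%:E).
  rewrite EFinD; apply: leeD.
    rewrite -sumEFin big_nat_cond [leRHS]big_nat_cond; apply: lee_sum => t /andP[/andP[_ tT] _].
    rewrite iint_sum// -sumEFin big_nat_cond [leRHS]big_nat_cond.
    by apply: lee_sum => s /andP[/andP[s0 _] _]; exact: iint_underestimated.
  rewrite -sumEFin; apply: lee_sum => s _; rewrite iintD// iint_cst EFinD leeD2lE//.
  exact: iint_overestimated.
rewrite lee_fin big_split/= addrA.
have fV0 t : 0 <= (flog R t.+1)^-1 by rewrite invr_ge0 (le_trans ler01)// flog_ge1.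
have L0 : 0 <= L by exact: ln_flog_ge0.
have hh : 0 < h ^+ 2 by rewrite exprn_gt0.
have B1 : \sum_(k <= t < T) \sum_(1 <= s < T) (flog R t.+1)^-1 * expR (- (s%:R * (h ^+ 2 / 2)))
    <= 3 * (h ^+ 2 / 2)^-1.
  under eq_bigr do rewrite -mulr_sumr.
  rewrite -mulr_suml; apply: ler_pM => //.
  - exact: sumr_ge0.
  - by apply: sumr_ge0 => s _; exact: expR_ge0.
  - by apply: le_trans (sum_flogV_le T); exact: ler_sum_nat_widen.
  - by apply: sum_expRN_le; rewrite divr_gt0.
have B2 : \sum_(1 <= s < T) ((s%:R < 8 * L / h ^+ 2)%R%:R : R) <= 8 * L / h ^+ 2.
  by apply: sum_small_le; rewrite divr_ge0 ?mulr_ge0// ltW.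
have B3 : \sum_(1 <= s < T) expR (- (s%:R * (h ^+ 2 / 8))) <= (h ^+ 2 / 8)^-1.
  by apply: sum_expRN_le; rewrite divr_gt0.
rewrite (_ : (14 + 8 * L) / h ^+ 2 = 3 * (h ^+ 2 / 2)^-1 + 8 * L / h ^+ 2 + (h ^+ 2 / 8)^-1).
  by apply: lerD => //; exact: lerD.
by field; rewrite gt_eqF.
Qed.

Lemma gap_iint_pulls_le (c : R) i a : 0 < c -> (i < k)%N -> (a < k)%N ->
  nth 0%R m i <= nth 0%R m a ->
  ((nth 0%R m a - nth 0%R m i)%:E *
     iint laws (fun ys => (pulls (ucb_hist k (table T ys) T) i)%:R%:E) <=
   (gap_cost R c (56 + 32 * L) T (nth 0%R m a - nth 0%R m i))%:E)%E.
Proof.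
move=> c0 ik ak mia; set d := nth 0%R m a - nth 0%R m i.
have d_ge0 : 0 <= d by rewrite subr_ge0.
rewrite /gap_cost; case: ifPn => [d_le0|]; last rewrite -ltNge => d0.
  by rewrite (_ : d = 0) ?mul0e//; apply/eqP; rewrite eq_le d_le0.
case: ifPn => [dc|_].
  (* For a small gap the trivial bound of [T] pulls suffices. *)
  apply: (@le_trans _ _ (d%:E * T%:R%:E)%E); last first.
    by rewrite -EFinM lee_fin mulrC ler_wpM2l.
  apply: lee_wpmul2l => //; rewrite -[leRHS](iint_cst laws).
  by apply: le_iint => ys; rewrite lee_fin ler_nat pulls_le.
have d1 : d <= 1 by have := m01 i ik; have := m01 a ak; rewrite /d; lra.
(* Taking [h = d / 2] multiplies 14 and 8 by 4; the initial pull costs [d <= 1]. *)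
have h0 : 0 < d / 2 by rewrite divr_gt0.
have gap : nth 0%R m a - nth 0%R m i = 2 * (d / 2) by rewrite mulrC divfK// pnatr_eq0.
apply: (le_trans (lee_wpmul2l _ (iint_pulls_le _ _ _ h0 ik ak gap))) => //.
rewrite -EFinM lee_fin; apply: (@le_trans _ _ (d + (56 + 32 * L) / d)).
  by rewrite le_eqVlt; apply/orP; left; apply/eqP; field; rewrite gt_eqF.
by rewrite lerD2r.
Qed.

(** Regret decomposition: exactly one arm is played at each time, so the regret is the sum over arms
    of gap times expected number of pulls. *)
Lemma ucb_regret_le (c : R) : 0 < c ->
  (ucb_regret P k T m <= (\sum_(i < k) gap_cost R c (56 + 32 * L) T
     (\big[Num.max/nth 0 m 0]_(j < k) nth 0 m j - nth 0 m i))%:E)%E.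
Proof.
move=> c0; rewrite /ucb_regret; have [a [ak -> ma]] := bigmax_nth _ m k k0.
set M := nth 0 m a; rewrite big_add1/=.
have act_lt (ys : seq R) t : (ucb_action k (table T ys) t.+1 < k)%N by exact: ucb_action_lt.
pose X t (ys : seq R) := nth 0 m (ucb_action k (table T ys) t.+1).
have mX t : measurable_fun setT (X t : seqM R -> R).
  rewrite (_ : X t = fun ys => nth 0 m (last 0%N (ucb_hist k (table T ys) t.+1))); last first.
    by apply/funext => ys; rewrite ucb_histS last_rcons.
  exact: (measurable_fun_ucb_hist _ _ _ _ (fun h => nth 0 m (last 0%N h))).
have X01 t ys : 0 <= X t ys <= 1 by exact: m01.
have XM t ys : X t ys <= M by exact: ma.
have mMX t : measurable_fun setT ((fun ys => (M - X t ys)%:E) : seqM R -> \bar R).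
  by apply: measurable_fun_EFin; exact: measurable_funB.
have Xfin t : (iint laws (fun ys => (X t ys)%:E)) \is a fin_num.
  rewrite ge0_fin_numE; last by apply: iint_ge0 => ys; rewrite lee_fin; case/andP: (X01 t ys).
  apply: (@le_lt_trans _ _ 1%E); last exact: ltry.
  rewrite -[leRHS](iint_cst laws); apply: le_iint => ys.
  by rewrite lee_fin; case/andP: (X01 t ys).
(* All integrands here are nonnegative, and the integral of [X t] is finite, so it may be cancelled
   in the extended reals. *)
have split_M t : (M%:E = iint laws (fun ys => (M - X t ys)%:E) + iint laws (fun ys => (X t ys)%:E))%E.
  rewrite -iintD//; first last.
  - exact: measurable_fun_EFin.
  - by move=> ys; rewrite lee_fin; case/andP: (X01 t ys).
  - by move=> ys; rewrite lee_fin subr_ge0.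
  by under eq_iint do rewrite -EFinD subrK; rewrite iint_cst.
have -> : ((T%:R * M)%:E - \sum_(0 <= t < T) iint laws (fun ys => (X t ys)%:E) =
    \sum_(0 <= t < T) iint laws (fun ys => (M - X t ys)%:E))%E.
  rewrite [X in (X%:E - _)%E](_ : _ = \sum_(0 <= t < T) M); last first.
    by rewrite sumr_const_nat subn0 mulr_natl.
  rewrite -sumEFin (eq_bigr _ (fun t _ => split_M t)).
  rewrite big_split/= addeK//.
  by apply/sum_fin_numP => t _ _; exact: Xfin.
pose G i t (ys : seq R) : \bar R := ((M - nth 0 m i) * (played k T i t ys)%:R)%:E.
have G0 (i : 'I_k) t ys : (0 <= G i t ys)%E by rewrite lee_fin mulr_ge0// subr_ge0 ma.
have mG i t : measurable_fun setT (G i t : seqM R -> \bar R).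
  apply: measurable_fun_EFin; apply: measurable_funM => //.
  by apply: measurable_fun_natb; exact: measurable_played.
have XG t ys : ((M - X t ys)%:E = \sum_(i < k) G i t ys)%E.
  rewrite sumEFin (bigD1 (Ordinal (act_lt ys t)))//= /played eqxx mulr1 big1 ?addr0//.
  move=> i ni; rewrite (_ : (_ == _) = false) ?mulr0//.
  by apply: contraNF ni => /eqP ia; apply/eqP/val_inj; rewrite /= ia.
have iXG t : (iint laws (fun ys => (M - X t ys)%:E) = \sum_(i < k) iint laws (G i t))%E.
  by rewrite -iint_sum//; apply: eq_iint => ys; exact: XG.
rewrite (eq_bigr _ (fun t _ => iXG t)) exchange_big/= -sumEFin; apply: lee_sum => i _.
rewrite -iint_sum//.
rewrite (eq_iint _ _ (fun ys =>
    (M - nth 0 m i)%:E * (pulls (ucb_hist k (table T ys) T) i)%:R%:E)%E); last first.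
  by move=> ys; rewrite sumEFin -mulr_sumr -natr_sum -pulls_playedE EFinM.
rewrite iintZl ?subr_ge0 ?ma//; last first.
  apply: measurable_fun_EFin.
  exact: (measurable_fun_ucb_hist _ _ _ _ (fun h => (pulls h i)%:R : R)).
by apply: gap_iint_pulls_le => //; exact: ma.
Qed.

End Frequentist.

(** * Integrating over the prior *)

Section GapIntegral.
Context {R : realType}.
Variables (c C : R) (T : nat).
Hypotheses (c0 : 0 < c) (c1 : c <= 1) (C0 : 0 <= C).

(** The antiderivative is [- C * ln (B - x)], so the integral over a proper interval is
    [C * (ln B - ln c)], and [ln B <= 0]. *)
Lemma integral_inv_dist (B : R) : B <= 1 ->
  (\int[lebesgue_measure]_(x in `[0%R, (B - c)%R]) (C / (B - x))%:E <= (C * ln c^-1)%:E)%E.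
Proof.
move=> B1; have lnc : 0 <= ln c^-1 by rewrite ln_ge0// invf_ge1.
have [Bc|Bc] := leP (B - c) 0.
  rewrite (_ : integral _ _ _ = 0%E) ?lee_fin ?mulr_ge0//.
  move: Bc; rewrite le_eqVlt => /predU1P[->|Bc]; first by rewrite set_itv1 integral_set1.
  by rewrite set_itv_ge ?integral_set0//= bnd_simp -ltNge.
have Bx x : x <= B - c -> 0 < B - x by move: c0; lra.
have dF (x : R) : x <= B - c -> is_derive x 1 (fun x => - C * ln (B - x)) (C / (B - x)).
  move=> xB; have lnD := is_derive1_ln (Bx _ xB).
  have dB : is_derive x 1 (fun y : R => B - y) (-1).
    have := is_deriveB (f := cst B) (g := id) (is_derive_cst B x 1) (is_derive_id x 1).
    by rewrite sub0r.
  have dln : is_derive x 1 (fun y => ln (B - y)) ((B - x)^-1 * -1).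
    exact: (is_derive1_comp (f := @ln R) (g := fun y => B - y) lnD dB).
  have := is_deriveZ (f := fun y => ln (B - y)) (- C) dln.
  by rewrite /GRing.scale/= mulrN1 mulrNN.
have cF (x : R) : x <= B - c -> {for x, continuous (fun x => - C * ln (B - x))}.
  by move=> /dF [dx _]; apply: differentiable_continuous; exact/derivable1_diffP.
rewrite (@continuous_FTC2 _ _ (fun x => - C * ln (B - x)))//.
- rewrite -EFinD lee_fin subr0 (_ : B - (B - c) = c); last by ring.
  have lnB : ln B <= 0 by rewrite ln_le0.
  by rewrite lnV ?posrE//; have := ler_wpM2l C0 lnB; lra.
- apply: continuous_in_subspaceT => x; rewrite inE/= in_itv/= => /andP[_ xB].
  apply: cvgM; first exact: cvg_cst.
  by apply: cvgV; [rewrite gt_eqF// Bx|apply: cvgB; [exact: cvg_cst|exact: cvg_id]].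
- split.
  + by move=> x; rewrite in_itv/= => /andP[_ /ltW /dF []].
  + by apply: cvg_at_right_filter; exact/cF/ltW.
  + by apply: cvg_at_left_filter; exact: cF.
- by move=> x; rewrite in_itv/= => /andP[_ /ltW /dF dx]; rewrite derive1E derive_val.
Qed.

Lemma measurable_gap_cost : measurable_fun setT (gap_cost R c C T).
Proof.
rewrite (_ : gap_cost R c C T = fun d => if d <= 0 then 0 else if d <= c then T%:R * c
    else 1 + C * expR (- ln d)).
  apply: measurable_fun_ifT; [exact: measurable_fun_ler|by []|].
  apply: measurable_fun_ifT; [exact: measurable_fun_ler|by []|].
  apply: measurable_funD => //; apply: measurable_funM => //.
  by apply: measurableT_comp => //; apply: measurable_funN; exact: measurable_ln.
apply/funext => d; rewrite /gap_cost; case: ifPn => //; rewrite -ltNge => d0.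
by rewrite expRN lnK ?posrE.
Qed.

(** The cost is dominated by three terms: [T * c] on [[B - c, B]], of length [c]; the constant 1;
    and [C / (B - x)] on [[0, B - c]]. *)
Lemma integral_gap_cost_le (B : R) : 0 <= B <= 1 ->
  (\int[lebesgue_measure]_(x in `[0%R, 1%R]) (gap_cost R c C T (B - x))%:E <=
   (T%:R * c ^+ 2 + (1 + C * ln c^-1))%:E)%E.
Proof.
move=> /andP[B0 B1].
pose f1 x : \bar R := ((T%:R * c)%:E * (\1_(`[B - c, B]%classic : set R) x)%:E)%E.
pose f3 x : \bar R := (((fun x => (C / (B - x))%:E) \_ (`[0%R, (B - c)%R]%classic : set R)) x)%E.
have mcost : measurable_fun setT (fun x : R => gap_cost R c C T (B - x)).
  by apply: (measurableT_comp measurable_gap_cost); exact: measurable_funB.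
have mf1 : measurable_fun setT f1.
  apply: measurable_funeM; apply: measurable_fun_EFin.
  by apply/measurable_indicP; exact: measurable_itv.
have f10 x : (0 <= f1 x)%E by rewrite /f1 -EFinM lee_fin !mulr_ge0// ltW.
have f30 x : (0 <= f3 x)%E.
  rewrite /f3 patchE; case: ifPn => //; rewrite inE/= in_itv/= => /andP[_ xB].
  by rewrite lee_fin divr_ge0//; move: c0; lra.
have mf3 : measurable_fun setT f3.
  rewrite (_ : f3 = fun x => (if (0 <= x) && (x <= B - c) then C * expR (- ln (B - x)) else 0)%:E).
    apply: measurable_fun_EFin; apply: measurable_fun_ifT => //.
      by apply: measurable_and; exact: measurable_fun_ler.
    apply: measurable_funM => //; apply: measurableT_comp => //; apply: measurable_funN.
    by apply: measurableT_comp; [exact: measurable_ln|exact: measurable_funB].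
  apply/funext => x; rewrite /f3 patchE mem_setE in_itv/=; case: ifPn => // /andP[_ xB].
  by rewrite expRN lnK// posrE; move: c0; lra.
apply: (@le_trans _ _ (\int[lebesgue_measure]_(x in `[0%R, 1%R]) (f1 x + (1 + f3 x)))%E).
  apply: ge0_le_integral => //.
  - by move=> x _; rewrite lee_fin gap_cost_ge0// ltW.
  - by apply: measurable_funTS; exact: measurable_fun_EFin.
  - apply: measurable_funTS; apply: emeasurable_funD => //.
    exact: emeasurable_funD.
  move=> x; rewrite /= in_itv/= => /andP[x0 x1]; rewrite /gap_cost.
  case: ifPn => [_|]; first by rewrite !adde_ge0.
  rewrite -ltNge => xB; case: ifPn => [xc|].
    rewrite /f1 indicE mem_set ?mule1 ?leeDl ?adde_ge0//= in_itv/=.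
    by apply/andP; split; move: xB xc; lra.
  rewrite -ltNge => xc; rewrite /f3 patchE mem_set/= ?in_itv/= ?x0/=; last first.
    by move: xc; lra.
  by rewrite EFinD leeDr.
rewrite ge0_integralD//; first last.
- by apply: measurable_funTS; exact: emeasurable_funD.
- by move=> x _; rewrite adde_ge0.
- exact: measurable_funTS.
rewrite EFinD leeD//.
  rewrite ge0_integralZl_EFin//; first last.
  - by rewrite mulr_ge0// ltW.
  - apply: measurable_funTS; apply: measurable_fun_EFin.
    by apply/measurable_indicP; exact: measurable_itv.
  rewrite integral_indic//.
  apply: (@le_trans _ _ ((T%:R * c)%:E * c%:E)%E); last by rewrite -EFinM expr2 mulrA.
  apply: lee_wpmul2l; first by rewrite lee_fin mulr_ge0// ltW.
  apply: (@le_trans _ _ (lebesgue_measure (`[B - c, B]%classic : set R))).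
    by apply: le_measure => //; rewrite inE//; exact: measurableI.
  rewrite lebesgue_measure_itv/= lte_fin ltrBlDr ltrDl c0 -EFinD lee_fin; lra.
rewrite ge0_integralD//; last exact: measurable_funTS.
rewrite EFinD leeD//.
  rewrite integral_cst//= mul1e [X in (X <= _)%E]lebesgue_measure_itv/=.
  by rewrite lte_fin ltr01 oppr0 adde0.
rewrite /f3 -integral_mkcondr; apply: le_trans (integral_inv_dist B B1).
rewrite (_ : _ `&` _ = `[0%R, (B - c)%R]%classic)//; apply/seteqP; split=> x /=.
  by case.
by rewrite !in_itv/= => /andP[x0 xB]; split=> //; rewrite x0/=; move: c0; lra.
Qed.

End GapIntegral.

(* The best arm other than [i], clipped so as to lie in [0, 1] whatever [m] is. *)
Definition best_other (R : realType) (k i : nat) (m : seq R) : R :=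
  Num.min 1 (\big[Num.max/0]_(j < k | (j : nat) != i) nth 0 m j).

Section BestOther.
Context {R : realType}.
Variables (k i : nat).

Lemma best_other01 (m : seq R) : 0 <= best_other R k i m <= 1.
Proof.
by rewrite /best_other le_min ge_min lexx ler01 /= bigmax_ge_id.
Qed.

Lemma best_other_set_nth (m : seq R) x :
  best_other R k i (set_nth 0 m i x) = best_other R k i m.
Proof.
congr Num.min; apply: eq_bigr => j ji.
by rewrite nth_set_nth /= (negbTE ji).
Qed.

Lemma measurable_best_other :
  measurable_fun setT (best_other R k i : seqM R -> R).
Proof.
apply: measurable_minr => //; rewrite /index_enum; elim: (Finite.enum _) => [|j s ih].
  by under eq_fun do rewrite big_nil; exact: measurable_cst.
under eq_fun do rewrite big_cons; case: ((j : nat) != i) => //.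
by apply: measurable_maxr => //; exact: measurable_nth.
Qed.

(** If arm [i] attains the maximum, both arguments are nonpositive and both costs vanish; otherwise
    the maximum is attained by another arm. The right-hand side isolates the mean of [i] from a
    quantity that does not depend on it. *)
Lemma gap_cost_best_other (c C : R) T (m : seq R) : (i < k)%N ->
  (forall j, (j < k)%N -> 0 <= nth 0 m j <= 1) ->
  gap_cost R c C T (\big[Num.max/nth 0 m 0]_(j < k) nth 0 m j - nth 0 m i) =
  gap_cost R c C T (best_other R k i m - nth 0 m i).
Proof.
move=> ik m01; have [a [ak -> ma]] := bigmax_nth R m k (leq_ltn_trans (leq0n _) ik).
have bo_le : best_other R k i m <= nth 0 m a.
  rewrite /best_other ge_min; apply/orP; right; apply/bigmax_leP; split.
    by case/andP: (m01 a ak).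
  by move=> j _; exact: ma.
have [ai|ai] := eqVneq (nth 0 m a) (nth 0 m i).
  by rewrite /gap_cost !ifT// subr_le0 -ai.
congr (gap_cost _ _ _ _ (_ - _)); apply/eqP; rewrite eq_le bo_le andbT.
rewrite /best_other le_min; case/andP: (m01 a ak) => _ -> /=.
apply: (le_bigmax_cond _ (fun j : 'I_k => nth 0 m j) (j := Ordinal ak)) => /=.
by apply: contra ai => /eqP ->.
Qed.

End BestOther.

(** * Domination of the prior by Lebesgue measure on [0, 1] *)

Section Prior.
Context {R : realType}.
Variables (Gam : probability R R) (g : R -> R) (D0 : R).
Hypothesis mg : measurable_fun (`[0, 1] : set R) g.
Hypothesis g0 : forall x : R, x \in `[0, 1] -> 0 <= g x.
Hypothesis GamE : forall A : set R, measurable A ->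
  Gam A = (\int[lebesgue_measure]_(x in A `&` (`[0%R, 1%R]%classic : set R)) (g x)%:E)%E.
Hypothesis gD0 : forall x : R, x \in `[0, 1] -> g x <= D0.

Lemma density_bound_ge0 : 0 <= D0.
Proof.
have I0 : (0 : R) \in `[0, 1] by rewrite in_itv/= lexx ler01.
exact: le_trans (g0 _ I0) (gD0 _ I0).
Qed.

Lemma prior_setC01 : Gam (~` `[0%R, 1%R]%classic : set R) = 0%E.
Proof. by rewrite GamE; [rewrite setICl integral_set0|exact: measurableC]. Qed.

Lemma prior_le_lebesgue (A : set R) : measurable A ->
  (Gam A <= D0%:E * lebesgue_measure A)%E.
Proof.
move=> mA; rewrite GamE//.
have mI : measurable (A `&` `[0%R, 1%R]%classic) by exact: measurableI.
apply: (@le_trans _ _ (\int[lebesgue_measure]_(x in A `&` `[0%R, 1%R]%classic) D0%:E)%E).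
  apply: ge0_le_integral => //.
  - by move=> x [_ x01]; rewrite lee_fin g0.
  - by apply/measurable_EFinP; apply: measurable_funS mg => //; exact: subIsetr.
  - by move=> x [_ x01]; rewrite lee_fin gD0.
rewrite integral_cst//; apply: lee_wpmul2l; first by rewrite lee_fin density_bound_ge0.
by apply: le_measure; rewrite ?inE//; exact: subIsetl.
Qed.

Lemma integral_prior_le (f : R -> \bar R) : (forall x, 0 <= f x)%E ->
  measurable_fun setT f ->
  (\int[Gam]_x f x <= D0%:E * \int[lebesgue_measure]_(x in `[0%R, 1%R]) f x)%E.
Proof.
move=> f0 mf.
pose N : set R := ~` `[0%R, 1%R]%classic.
rewrite (ge0_negligible_integral (N := N))//; first last.
- exact: prior_setC01.
- exact: measurableC.
rewrite setTD /N setCK.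
(* [lebesgue_measure] and [Gam] live on copies of [R] with different displays. *)
pose phi : measurableTypeR R -> R := id.
have mphi : measurable_fun setT phi by exact: measurable_id.
pose leb : {measure set R -> \bar R} := pushforward lebesgue_measure phi.
pose scaled : {measure set R -> \bar R} := mscale (NngNum density_bound_ge0) (leb mphi).
have <- : (\int[scaled]_(x in `[0%R, 1%R]) f x =
    D0%:E * \int[lebesgue_measure]_(x in `[0%R, 1%R]) f x)%E.
  rewrite ge0_integral_mscale//; last exact: measurable_funTS.
  by rewrite (ge0_integral_pushforward mphi)//; exact: measurable_funTS.
apply: (@ge0_le_measure_integral _ _ _ Gam scaled) => // A mA.
exact: prior_le_lebesgue.
Qed.

End Prior.

(** The coefficient 28 of [lT] exceeds 10 by 18; the excess [18 * lT] is paid by the constant 20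
    when [lT <= 1] and by [36 * L] when [lT <= L]. *)
Lemma numeric_bound (R : realType) (D0 L lT lk : R) :
  0 <= D0 -> 0 <= L -> 0 <= lT -> 0 <= lk -> lT <= 1 \/ lT <= L ->
  D0 * (1 + (1 + (56 + 32 * L) * (lT / 2))) <=
  1 + D0 + D0 * (10 + 18 * L) * (2 + 2 * lk + lT).
Proof.
move=> D00 L0 lT0 lk0 lTL.
have E : (28 + 16 * L) * lT + 1 <= (10 + 18 * L) * (2 + 2 * lk + lT).
  have lkL : 0 <= lk * L by exact: mulr_ge0.
  have LT : 0 <= L * lT by exact: mulr_ge0.
  by case: lTL => lTL; nra.
by have := ler_wpM2l D00 E; nra.
Qed.

Theorem theorem2 (R : realType) (k T : nat) (P : R -> probability R R)
  (Gam : probability R R) (g : R -> R) (D0 : R) :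
  (0 < k)%N -> (0 < T)%N ->
  (forall A : set R, measurable A -> measurable_fun (`[0, 1] : set R) (fun m : R => (P m A : \bar R))) ->
  (forall m : R, m \in `[0, 1] ->
     (P m).-integrable setT (fun x => x%:E) /\
     (\int[P m]_x x%:E = m%:E)%E) ->
  (forall m : R, m \in `[0, 1] -> forall s : R,
     (\int[P m]_x (expR (s * (x - m)))%:E <= (expR (s ^+ 2 / 2))%:E)%E) ->
  measurable_fun (`[0, 1] : set R) g ->
  (forall x : R, x \in `[0, 1] -> 0 <= g x) ->
  (forall A : set R, measurable A ->
     Gam A = (\int[lebesgue_measure]_(x in A `&` (`[0%R, 1%R]%classic : set R)) (g x)%:E)%E) ->
  (forall x : R, x \in `[0, 1] -> g x <= D0) ->
  (ucb_bayes_regret P Gam k T <=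
   (k%:R * (1 + D0 + D0 * (10 + 18 * ln (flog R T))
                          * (2 + 2 * ln (k%:R : R) + ln (T%:R : R))))%:E)%E.
Proof.
move=> k0 T0 _ _ subg mg g0 GamE gD0.
have D00 := density_bound_ge0 _ _ g0 gD0.
set L := ln (flog R T); have L0 : 0 <= L by exact: ln_flog_ge0.
pose C := 56 + 32 * L; have C0 : 0 <= C by rewrite addr_ge0// mulr_ge0.
have T1 : 1 <= T%:R :> R by rewrite ler1n.
have Tpos : 0 < T%:R :> R by exact: lt_le_trans ltr01 T1.
(* This cut-off keeps the cost [T * c ^+ 2] of small gaps equal to 1, while ln (1 / c) is only half
   of ln T. *)
pose c : R := (Num.sqrt T%:R)^-1.
have c0 : 0 < c by rewrite invr_gt0 sqrtr_gt0.
have c1 : c <= 1 by rewrite invf_le1 ?sqrtr_gt0// -[leLHS]sqrtr1 ler_wsqrtr.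
have Tc : T%:R * c ^+ 2 = 1 by rewrite exprVn sqr_sqrtr ?ltW// divff// gt_eqF.
have lnc : ln c^-1 = ln (T%:R : R) / 2.
  rewrite invrK -[in RHS](sqr_sqrtr (ltW Tpos)) lnXn ?sqrtr_gt0//.
  by rewrite mulr2n; field.
pose cost i (m : seq R) := gap_cost R c C T (best_other R k i m - nth 0 m i).
have cost0 i m : (0 <= (cost i m)%:E)%E by rewrite lee_fin gap_cost_ge0// ltW.
have mcost i : measurable_fun setT ((fun m => (cost i m)%:E) : seqM R -> \bar R).
  apply: measurable_fun_EFin; apply: (measurableT_comp (measurable_gap_cost _ _ _)).
  by apply: measurable_funB; [exact: measurable_best_other|exact: measurable_nth].
apply: (@le_trans _ _ (iint (nseq k Gam) (fun m => \sum_(i < k) (cost i m)%:E)%E)).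
  apply: (@le_iint_in _ _ (`[0%R, 1%R]%classic)) => //.
  - by move=> mu /nseqP[-> _]; exact: prior_setC01 GamE.
  - by move=> m; exact: sume_ge0.
  - exact: emeasurable_sum.
  move=> m sm mD; rewrite size_nseq in sm.
  have m01 i : (i < k)%N -> nth 0 m i \in `[0, 1].
    by move=> ik; apply: mD; rewrite mem_nth ?sm.
  have m01' i : (i < k)%N -> 0 <= nth 0 m i <= 1 by move=> /m01; rewrite in_itv.
  apply: le_trans (ucb_regret_le k T P m k0 m01' _ c c0) _.
    by move=> i ik s; apply: subg; exact: m01.
  rewrite -sumEFin; apply: lee_sum => i _.
  by rewrite gap_cost_best_other.
rewrite iint_sum//.
apply: (@le_trans _ _ (\sum_(i < k) (D0 * (T%:R * c ^+ 2 + (1 + C * ln c^-1)))%:E)%E).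
  apply: lee_sum => i _.
  (* The mean of arm [i] is integrated first, with the other means frozen: [best_other] is then a
     constant [B] in [[0, 1]]. *)
  rewrite (iint_set_nth Gam _ i)//; last by rewrite size_nseq.
  rewrite -[leRHS](iint_cst (nseq k Gam)); apply: le_iint => m.
  rewrite nth_nseq ltn_ord.
  under eq_integral do rewrite /cost best_other_set_nth nth_set_nth /= eqxx.
  apply: le_trans (integral_prior_le _ _ _ mg g0 GamE gD0 _ _ _) _.
  - by move=> x; rewrite lee_fin gap_cost_ge0// ltW.
  - apply: measurable_fun_EFin; apply: (measurableT_comp (measurable_gap_cost _ _ _)).
    exact: measurable_funB.
  rewrite EFinM; apply: lee_wpmul2l; first by rewrite lee_fin.
  by apply: integral_gap_cost_le => //; exact: best_other01.
rewrite sumEFin lee_fin sumr_const card_ord -[leLHS]mulr_natl ler_wpM2l// Tc lnc.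
apply: numeric_bound => //; rewrite ?ln_ge0 ?ler1n//.
exact: ln_le1_or_le_ln_flog.
Qed.
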